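(* Assume that the law $Q_N$ of the random graph $G_N$ is such that almost all sequences $(G_N)_{N\ge1}$ are locally tree-like with asymptotic degree $D$, uniformly sparse, and with asymptotic degree distribution (the law of $D$) having strongly finite mean. Then, for all $(\beta,B)\in\mathcal U^{\mathrm{qu}}$, $S_N/N$ converges to $M(\beta,B)$ in probability with respect to the averaged quenched measure $P_N$ as $N\to\infty$; that is, for all $\varepsilon>0$, $$\lim_{N\to\infty}P_N\left(\left|\frac{S_N}{N}-M(\beta,B)\right|>\varepsilon\right)=0 .$$
   Context: Graphs. $G_N$ is a random graph (possibly a multigraph) with law $Q_N$, vertex set $[N]=\{1,\dots,N\}$ and edge set $E_N$ (sums over $E_N$ count each edge once, with multiplicity). $D$ is a random variable on $\{1,2,\dots\}$ with $\mathbb P(D=k)=p_k$ and $\mathbb E[D]<\infty$; $\rho_k=(k+1)p_{k+1}/\mathbb E[D]$, $k\ge0$, is its size-biased law, and $\nu=\sum_{k\ge 0}k\rho_k=\mathbb E[D(D-1)]/\mathbb E[D]\in[0,\infty]$. $\mathcal T(D,\rho,\ell)$ is the random rooted tree given by a branching process with $\ell$ generations in which the root has offspring number distributed as $D$ and all vertices in later generations have i.i.d. offspring numbers with law $\rho$. $B_i(t)$ is the subgraph of $G_N$ induced by the vertices at graph distance at most $t$ from $i$, rooted at $i$; $\cong$ is isomorphism of rooted graphs. - $(G_N)$ is locally tree-like with asymptotic degree $D$ if, for every $t$ and every rooted tree $\mathcal T$ with $t$ generations, almost surely $\lim_{N\to\infty}\mathbb P_N(B_i(t)\cong\mathcal T)=\mathbb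 P(\mathcal T(D,\rho,t)\cong\mathcal T)$, where $\mathbb P_N$ refers to the uniform choice of $i\in[N]$ (given $G_N$). - $(G_N)$ is uniformly sparse if almost surely $\lim_{\ell\to\infty}\limsup_{N\to\infty}\frac1N\sum_{i\in[N]}d_i\mathbf 1_{\{d_i\ge\ell\}}=0$, where $d_i$ is the degree of $i$ in $G_N$. - The law of $D$ has strongly finite mean if there are $\tau>2$, $c>0$ with $\sum_{i\ge k}p_i\le ck^{-(\tau-1)}$ for all $k\ge 1$. Ising model. For $\beta\ge0$, $B\in\mathbb R$ and $\sigma\in\{-1,1\}^N$, the random quenched measure is $$\mu_{G_N}(\sigma)=\frac{1}{Z_N(\beta,B)}\exp\Big[\beta\sum_{(i,j)\in E_N}\sigma_i\sigma_j+B\sum_{i\in[N]}\sigma_i\Big],$$ with $Z_N(\beta,B)$ the normalizing partition function. The averaged quenched measure is $P_N(\sigma)=Q_N(\mu_{G_N}(\sigma))$, i.e. the expectation of $\mu_{G_N}(\sigma)$ over $G_N\sim Q_N$. The same symbols denote the corresponding expectations. $S_N=\sum_{i\in[N]}\sigma_i$, $M_N(\beta,B)=\mu_{G_N}(S_N/N)$. The critical inverse temperature is $\beta_c^{\mathrm{qu}}=\operatorname{atanh}(1/\nu)$ (with value $+\infty$ if $\nu\le1$ and $0$ if $\nu=\infty$), and $$\mathcal U^{\mathrm{qu}}=\{(\beta,B):\beta\ge0,\ B\ne0\}\cup\{(\beta,B):0<\beta<\beta_c^{\mathrm{qu}},\ B=0\}.$$ It is known that, for such graph sequences, the pressure $\psi(\beta,B)=\lim_{N\to\infty}\frac1N\log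 Z_N(\beta,B)$ exists almost surely and is non-random, and that for $(\beta,B)\in\mathcal U^{\mathrm{qu}}$ the magnetization $M(\beta,B)=\lim_{N\to\infty}M_N(\beta,B)$ exists almost surely, with $M(\beta,B)=\frac{\partial}{\partial B}\psi(\beta,B)$ for $B\neq0$ and $M(\beta,0)=0$ for $0<\beta<\beta_c^{\mathrm{qu}}$. *)

(* Defs.v *)
From HB Require Import structures.
From mathcomp Require Import all_boot all_order all_algebra.
From mathcomp Require Import all_classical all_reals all_analysis.

Set Implicit Arguments.
Unset Strict Implicit.
Unset Printing Implicit Defensive.

Import Order.TTheory GRing.Theory Num.Theory.
Import numFieldNormedType.Exports.

Local Open Scope classical_set_scope.
Local Open Scope ring_scope.

(* A finite multigraph on the vertex set 'I_N is given by the list of its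
   edges, each listed once per multiplicity, with an arbitrary order of the
   edges and an arbitrary orientation of each edge; loops are allowed.  None of
   the notions below depends on the order or on the orientations. *)
Definition multigraph (N : nat) : Type := seq ('I_N * 'I_N).

Section Multigraph.
Variables (N : nat) (g : multigraph N).

Definition edge_mult (i j : 'I_N) : nat :=
  count [pred e | (e == (i, j)) || (e == (j, i))] g.

(* a loop contributes 2 to the degree of its vertex *)
Definition degree (i : 'I_N) : nat :=
  \sum_(e <- g) ((e.1 == i) + (e.2 == i))%N.

Definition adjacent : rel 'I_N := fun i j => (0 < edge_mult i j)%N.

Definition dist_le (t : nat) (i j : 'I_N) : Prop :=
  exists q : seq 'I_N, [/\ (size q <= t)%N, path adjacent i q & last i q = j].

End Multigraph.

Record rooted_graph : Type := RootedGraph {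
  rg_carrier : Type;
  rg_verts : set rg_carrier;
  rg_mult : rg_carrier -> rg_carrier -> nat;
  rg_root : rg_carrier
}.

Arguments rg_verts : clear implicits.
Arguments rg_mult : clear implicits.
Arguments rg_root : clear implicits.

Definition rooted_iso (A B : rooted_graph) : Prop :=
  exists f : rg_carrier A -> rg_carrier B,
    [/\ set_bij (rg_verts A) (rg_verts B) f,
        f (rg_root A) = rg_root B &
        forall x y, rg_verts A x -> rg_verts A y ->
          rg_mult B (f x) (f y) = rg_mult A x y].

Definition ball_graph (N : nat) (g : multigraph N) (i : 'I_N) (t : nat) :
    rooted_graph :=
  @RootedGraph 'I_N [set j | dist_le g t i j] (edge_mult g) i.

(* Every finite rooted tree is isomorphic to the rooted graph of a finite plane
   tree.  The vertices of the latter are addressed by lists of child indices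
   read from the root, which is [::]; generation = length of the address. *)
Inductive ptree : Type := PNode of seq ptree.

HB.instance Definition _ := gen_eqMixin ptree.
HB.instance Definition _ := gen_choiceMixin ptree.

Definition children (T : ptree) : seq ptree := let: PNode s := T in s.

Fixpoint is_node (T : ptree) (u : seq nat) : bool :=
  if u is k :: u' then
    (k < size (children T))%N && is_node (nth (PNode [::]) (children T) k) u'
  else true.

Definition is_parent (u v : seq nat) : bool :=
  (v != [::]) && (u == take (size v).-1 v).

Definition tree_graph (T : ptree) : rooted_graph :=
  @RootedGraph (seq nat) [set u | is_node T u]
    (fun u v => nat_of_bool (is_parent u v || is_parent v u)) [::].

(* extinction before generation t is allowed *)
Definition has_generations (t : nat) (T : ptree) : Prop :=
  forall u, is_node T u -> (size u <= t)%N.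

Section DegreeLaw.
Variables (R : realType) (p : nat -> R).

Definition is_degree_law : Prop :=
  [/\ forall k, 0 <= p k, p 0%N = 0 & (\sum_(0 <= k <oo) (p k)%:E = 1)%E].

Definition mean_degree : \bar R := (\sum_(0 <= k <oo) (k%:R * p k)%:E)%E.

Definition size_biased (k : nat) : R := k.+1%:R * p k.+1 / fine mean_degree.

Definition nu : \bar R := (\sum_(0 <= k <oo) (k%:R * size_biased k)%:E)%E.

Definition strongly_finite_mean : Prop :=
  exists tau c : R, [/\ 2 < tau, 0 < c &
    forall k : nat, (1 <= k)%N ->
      (\sum_(k <= i <oo) (p i)%:E <= (c * k%:R `^ (- (tau - 1)))%:E)%E].

(* Probability that the branching process stopped at generation t, with root
   offspring law q and independent offspring of law rho for the later vertices,
   produces the plane tree T (children being ordered by birth). *)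
Fixpoint branching_mass (rho q : nat -> R) (t : nat) (T : ptree) : R :=
  let: PNode s := T in
  if t is t'.+1 then q (size s) * \prod_(T' <- s) branching_mass rho rho t' T'
  else (size s == 0%N)%:R.

(* the probability that T(D, rho, t) is isomorphic to T as a rooted graph *)
Definition branching_prob (t : nat) (T : ptree) : \bar R :=
  (\esum_(T' in [set T' | rooted_iso (tree_graph T') (tree_graph T)])
     (branching_mass size_biased p t T')%:E)%E.

Definition atanh (x : R) : R := ln ((1 + x) / (1 - x)) / 2.

Definition beta_c : \bar R :=
  if (nu <= 1)%E then +oo%E
  else if nu == +oo%E then 0%E
  else (atanh (fine nu)^-1)%:E.

Definition Uqu (beta B : R) : Prop :=
  (0 <= beta /\ B <> 0) \/ [/\ 0 < beta, (beta%:E < beta_c)%E & B = 0].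

End DegreeLaw.

Section GraphSequence.
Variables (R : realType) (g : forall N : nat, multigraph N).

Definition ball_frequency (t : nat) (T : ptree) (N : nat) : R :=
  #|[set i : 'I_N | `[< rooted_iso (ball_graph (g N) i t) (tree_graph T) >]]%SET|%:R
    / N%:R.

Definition locally_tree_like (p : nat -> R) : Prop :=
  forall (t : nat) (T : ptree), has_generations t T ->
    (ball_frequency t T N)%:E @[N --> \oo] --> branching_prob p t T.

Definition uniformly_sparse : Prop :=
  limn_esup (fun N : nat =>
    ((\sum_(i < N | (l <= degree (g N) i)%N) (degree (g N) i)%:R) / N%:R : R)%:E)
  @[l --> \oo] --> 0%:E.

End GraphSequence.

Definition config (N : nat) := {ffun 'I_N -> bool}.

Section Ising.
Variables (R : realType) (N : nat).

Definition spin (s : config N) (i : 'I_N) : R := if s i then 1 else - 1.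

Definition total_spin (s : config N) : R := \sum_(i < N) spin s i.

Variables (g : multigraph N) (beta B : R).

Definition ising_weight (s : config N) : R :=
  expR (beta * (\sum_(e <- g) spin s e.1 * spin s e.2) + B * total_spin s).

Definition partition_function : R := \sum_(s : config N) ising_weight s.

Definition quenched (s : config N) : R := ising_weight s / partition_function.

Definition finite_magnetization : R :=
  \sum_(s : config N) quenched s * (total_spin s / N%:R).

End Ising.

Section RandomGraphs.
Variables (R : realType) (d : measure_display) (Omega : measurableType d).
Variables (P : probability Omega R) (G : forall N : nat, Omega -> multigraph N).

(* multigraph N is countable and carries the discrete sigma-algebra *)
Definition random_multigraphs : Prop :=
  forall (N : nat) (g : multigraph N), measurable (G N @^-1` [set g]).

Definition averaged_quenched (N : nat) (beta B : R) (s : config N) : \bar R :=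
  'E_P[fun w => quenched (G N w) beta B s].

Definition averaged_quenched_prob (N : nat) (beta B : R)
    (A : pred (config N)) : \bar R :=
  (\sum_(s | A s) averaged_quenched beta B s)%E.

Definition is_magnetization (p : nat -> R) (M : R -> R -> R) : Prop :=
  forall beta B : R, Uqu p beta B ->
    {ae P, forall w,
      finite_magnetization (G N w) beta B @[N --> \oo] --> M beta B}.

End RandomGraphs.

(* Main.v *)
Require Import Defs.
From HB Require Import structures.
From mathcomp Require Import all_boot all_order all_algebra.
From mathcomp Require Import all_classical all_reals all_analysis.
From mathcomp Require Import measurable_realfun ring lra zify.
Import Order.TTheory GRing.Theory Num.Theory.
Import numFieldNormedType.Exports.
Local Open Scope classical_set_scope.
Local Open Scope ring_scope.
Set Implicit Arguments.
Unset Strict Implicit.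
Unset Printing Implicit Defensive.

(** By Chebyshev's inequality (chebyshev_magnetization) the quenched probability
    of a deviation of S_N/N from M is at most
    eps^-2 (Var(S_N)/N^2 + (M_N - M)^2).  Since M_N -> M almost surely by
    assumption, the quenched statement reduces to Var(S_N) = o(N^2), for almost
    every realization of the graphs; the averaged statement then follows by
    dominated convergence, probabilities being bounded by 1.

    For B <> 0 the bound Var(S_N) <= N/|B| holds on every finite graph
    (spin_variance_le).  By symmetry B > 0.  As a function of the field,
    E[S_N] has derivative Var(S_N), and the derivative of Var(S_N) is the third
    cumulant of S_N, which is nonpositive for B >= 0 by the
    Griffiths-Hurst-Sherman inequality (ghs_moments).  Hence the variance
    decreases with the field, and the mean value theorem on [0, B] gives
    B Var(S_N) <= E[S_N] <= N.  The GHS inequality is proved with four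
    independent replicas, following Ellis and Monroe: after an orthogonal change
    of variables at every vertex the interaction is a positive combination of
    monomials, the field only couples to the first new variable, and all single
    site moments of the new variables are nonnegative (site_moment_ge0); the
    power series of the exponential then shows that all moments of the new
    variables are nonnegative (replica_weight_positive).  Minus the third
    cumulant is a sum of such moments, up to a positive factor.

    For B = 0 and beta below the critical value, E[S_N] = 0 and the variance is
    the sum over (i, j) of the correlations E[s_i s_j] >= 0.  Let theta be the
    hyperbolic tangent of beta.  Deleting an edge (u, k) lowers the correlation
    of u and j by at most theta times the correlation of k and j in the
    remaining graph (correlation_edge); descending along a ball of radius t
    around i which is a tree T, this bounds the correlation of i with any vertex
    outside the ball by theta^t times the number of vertices of T in
    generation t (ball_correlation_le).  In the branching process this number
    has mean E[D] nu^(t-1), and nu theta < 1 in the subcritical regime.  So for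
    t large there are finitely many trees of total probability at least
    1 - delta on which the bound is at most delta (typical_trees).  By local
    convergence a proportion of about 1 - delta of the vertices see one of these
    trees, and each of them contributes at most a constant plus N delta to the
    sum of the correlations (zero_field_variance_cvg). *)

(** * Positivity of moments in rotated replica variables *)

Lemma sum_pair (V : nmodType) (A B : finType) (F : A * B -> V) :
  \sum_p F p = \sum_a \sum_b F (a, b).
Proof. by rewrite pair_bigA; apply: eq_bigr => -[]. Qed.

Section ReplicaCone.
Variables (R : realType) (N : nat).
Implicit Types (k : 'I_N -> 'I_4 -> nat).

Notation site := ((bool * bool) * (bool * bool))%type.
Notation replicas := {ffun 'I_N -> site}.

Definition signb (b : bool) : R := if b then 1 else -1.

(** Twice an orthogonal transformation of the spins of four replicas at one
    vertex.  The first coordinate is the only one that feels the field.  The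
    sign of the second one is chosen so that the product of the four coordinates
    is never negative. *)
Definition rotated (a : 'I_4) (x : site) : R :=
  let: ((x1, x2), (x3, x4)) := x in
  match val a with
  | 0 => signb x1 + signb x2 + signb x3 + signb x4
  | 1 => - signb x1 - signb x2 + signb x3 + signb x4
  | 2 => signb x1 - signb x2 + signb x3 - signb x4
  | _ => signb x1 - signb x2 - signb x3 + signb x4
  end.

Definition rot_mono k (q : replicas) : R := \prod_v \prod_a rotated a (q v) ^+ k v a.

(** The uniform measure on four spins becomes the uniform measure on the eight
    points +- 4 e_a and the eight points (+- 2, +- 2, +- 2, +- 2) with an even number
    of minus signs.  The first eight points are symmetric under changing one
    sign; on the others a monomial is a power of 2 times a character of the
    group of even sign changes, whose sum is 0 or 8. *)
Lemma site_moment_ge0 (k : 'I_4 -> nat) :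
  0 <= \sum_(x : site) \prod_a rotated a x ^+ k a.
Proof.
rewrite !sum_pair !big_bool /= !sum_pair !big_bool /=.
rewrite !big_ord_recl !big_ord0 /rotated /signb /=.
set k0 := k _; set k1 := k _; set k2 := k _; set k3 := k _.
(* evaluate the four coordinates at each of the sixteen points *)
do ?[match goal with |- context [GRing.exp (GRing.add ?a ?b) _] =>
  first [have -> : a + b = 0 by ring | have -> : a + b = 2 by ring
    | have -> : a + b = - 2 by ring | have -> : a + b = 4 by ring
    | have -> : a + b = - 4 by ring] end].
have p4 n : (- 4 : R) ^+ n = (-1) ^+ odd n * 4 ^+ n.
  by rewrite signr_odd -exprNn.
have p2 n : (- 2 : R) ^+ n = (-1) ^+ odd n * 2 ^+ n.
  by rewrite signr_odd -exprNn.
rewrite !p4 !p2 !expr0n.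
have h (n : nat) : 0 <= (n == 0)%:R :> R by rewrite ler0n.
have g n : 0 <= 2 ^+ n :> R by rewrite exprn_ge0.
have f n : 0 <= 4 ^+ n :> R by rewrite exprn_ge0.
have := (mulr_ge0 (mulr_ge0 (g k0) (g k1)) (mulr_ge0 (g k2) (g k3)),
  mulr_ge0 (mulr_ge0 (f k0) (h k1)) (mulr_ge0 (h k2) (h k3)),
  mulr_ge0 (mulr_ge0 (h k0) (f k1)) (mulr_ge0 (h k2) (h k3)),
  mulr_ge0 (mulr_ge0 (h k0) (h k1)) (mulr_ge0 (f k2) (h k3)),
  mulr_ge0 (mulr_ge0 (h k0) (h k1)) (mulr_ge0 (h k2) (f k3))).
case=> -[] [] [].
move: (k0 == _)%:R (k1 == _)%:R (k2 == _)%:R (k3 == _)%:R.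
move: (2 ^+ k0) (2 ^+ k1) (2 ^+ k2) (2 ^+ k3) (4 ^+ k0) (4 ^+ k1) (4 ^+ k2) (4 ^+ k3).
move=> a0 a1 a2 a3 b0 b1 b2 b3 c0 c1 c2 c3 p0 p1 p2' p3 p4'.
by case: (odd k0); case: (odd k1); case: (odd k2); case: (odd k3);
  rewrite !(expr0, expr1); lra.
Qed.

(** The vertices are independent under the uniform measure. *)
Lemma rot_mono_sum_ge0 k : 0 <= \sum_q rot_mono k q.
Proof.
rewrite /rot_mono -(bigA_distr_bigA (fun v x => \prod_a rotated a x ^+ k v a)).
by apply: prodr_ge0 => v _; exact: site_moment_ge0.
Qed.

Lemma rot_monoM k k' q :
  rot_mono k q * rot_mono k' q = rot_mono (fun v a => k v a + k' v a)%N q.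
Proof.
rewrite /rot_mono -big_split; apply: eq_bigr => v _ /=; rewrite -big_split.
by apply: eq_bigr => a _; rewrite exprD.
Qed.

Lemma rot_monoX k n q :
  rot_mono k q ^+ n = rot_mono (fun v a => k v a * n)%N q.
Proof.
rewrite /rot_mono -prodrXl; apply: eq_bigr => v _; rewrite -prodrXl.
by apply: eq_bigr => a _; rewrite exprM.
Qed.

Definition rot_exponent (v : 'I_N) (a : 'I_4) : 'I_N -> 'I_4 -> nat :=
  fun w b => ((w == v) && (b == a))%N.

Lemma rot_mono1 v a q : rot_mono (rot_exponent v a) q = rotated a (q v).
Proof.
rewrite /rot_mono (bigD1 v)//= (bigD1 a)//= /rot_exponent !eqxx expr1.
rewrite !big1 ?mulr1// => [w /negPf wv|b /negPf ->]; last exact: expr0.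
by rewrite big1// => b _; rewrite wv expr0.
Qed.

(** The cone of weights under which all moments of the rotated variables are
    nonnegative. *)
Definition rot_positive (f : replicas -> R) : Prop :=
  forall k, 0 <= \sum_q f q * rot_mono k q.

Lemma rot_positive1 : rot_positive (fun=> 1).
Proof. by move=> k; under eq_bigr do rewrite mul1r; exact: rot_mono_sum_ge0. Qed.

(** Each partial sum of the exponential series only produces monomials with
    nonnegative coefficients, and the cone is closed under limits. *)
Lemma rot_positive_expR f k c : 0 <= c -> rot_positive f ->
  rot_positive (fun q => f q * expR (c * rot_mono k q)).
Proof.
move=> c0 fpos k'.
pose u n := \sum_q f q * series (exp_coeff (c * rot_mono k q)) n * rot_mono k' q.
have u_ge0 n : 0 <= u n.
  rewrite /u /series/=.
  under eq_bigr do rewrite mulr_sumr mulr_suml.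
  rewrite exchange_big/=; apply: sumr_ge0 => i _.
  have -> : \sum_q f q * exp_coeff (c * rot_mono k q) i * rot_mono k' q =
      c ^+ i / i`!%:R * \sum_q f q * rot_mono (fun v a => k v a * i + k' v a)%N q.
    rewrite mulr_sumr; apply: eq_bigr => q _.
    by rewrite -rot_monoM -rot_monoX /exp_coeff/= exprMn; ring.
  by rewrite mulr_ge0// divr_ge0// exprn_ge0.
have cvgu : u @ \oo --> \sum_q f q * expR (c * rot_mono k q) * rot_mono k' q.
  apply: cvg_big => [|q _]; first exact: add_continuous.
  apply: cvgMr_tmp; apply: cvgMl_tmp.
  exact: is_cvg_series_exp_coeff.
rewrite -(cvg_lim _ cvgu)//; apply: limr_ge; first by apply/cvg_ex; eexists; exact: cvgu.
by apply: nearW.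
Qed.

End ReplicaCone.

(** * The Griffiths-Hurst-Sherman inequality *)

Section SpinMoments.
Variables (R : realType) (N : nat) (g : multigraph N) (beta : R).

Definition spin_moment (B : R) (k : nat) : R :=
  \sum_(s : config N) ising_weight g beta B s * total_spin R s ^+ k.

Lemma ising_weight_gt0 B s : 0 < ising_weight g beta B s.
Proof. exact: expR_gt0. Qed.

Lemma partition_functionE B : partition_function g beta B = spin_moment B 0.
Proof. by apply: eq_bigr => s _; rewrite expr0 mulr1. Qed.

Lemma partition_function_gt0 B : 0 < partition_function g beta B.
Proof.
rewrite /partition_function (bigD1 [ffun=> true])//=.
by rewrite ltr_pwDl ?ising_weight_gt0// sumr_ge0// => s _; exact: expR_ge0.
Qed.

Lemma spin_moment0_gt0 B : 0 < spin_moment B 0.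
Proof. by rewrite -partition_functionE partition_function_gt0. Qed.

Lemma sum_cubic B (F : config N -> R) (a b c d : R) :
  (forall s, F s = ising_weight g beta B s *
     (a + b * total_spin R s + c * total_spin R s ^+ 2 + d * total_spin R s ^+ 3)) ->
  \sum_s F s = a * spin_moment B 0 + b * spin_moment B 1 + c * spin_moment B 2 +
    d * spin_moment B 3.
Proof.
move=> FE; rewrite /spin_moment !mulr_sumr -!big_split; apply: eq_bigr => s _ /=.
by rewrite FE; ring.
Qed.

Notation site := ((bool * bool) * (bool * bool))%type.
Notation replicas := {ffun 'I_N -> site}.

Definition replica1 (q : replicas) : config N := [ffun v => (q v).1.1].
Definition replica2 (q : replicas) : config N := [ffun v => (q v).1.2].
Definition replica3 (q : replicas) : config N := [ffun v => (q v).2.1].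
Definition replica4 (q : replicas) : config N := [ffun v => (q v).2.2].

(** A field of four spins is the same as four fields of one spin. *)
Lemma sum_replicas (F : config N -> config N -> config N -> config N -> R) :
  \sum_q F (replica1 q) (replica2 q) (replica3 q) (replica4 q) =
  \sum_s1 \sum_s2 \sum_s3 \sum_s4 F s1 s2 s3 s4.
Proof.
pose h (p : (config N * config N) * (config N * config N)) : replicas :=
  [ffun v => ((p.1.1 v, p.1.2 v), (p.2.1 v, p.2.2 v))].
have h_bij : bijective h.
  exists (fun q => ((replica1 q, replica2 q), (replica3 q, replica4 q))).
    move=> [[s1 s2] [s3 s4]]; rewrite /replica1 /replica2 /replica3 /replica4.
    by congr (_, _, (_, _)); apply/ffunP => v; rewrite !ffunE.
  move=> q; apply/ffunP => v; rewrite !ffunE /=.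
  by case: (q v) => -[? ?] [? ?].
rewrite (reindex h)/=; last exact: onW_bij.
rewrite !sum_pair; apply: eq_bigr => s1 _; apply: eq_bigr => s2 _.
rewrite !sum_pair; apply: eq_bigr => s3 _; apply: eq_bigr => s4 _.
by congr F; apply/ffunP => v; rewrite !ffunE.
Qed.

Lemma rot_orthogonal (x y : site) :
  signb R x.1.1 * signb R y.1.1 + signb R x.1.2 * signb R y.1.2 +
    signb R x.2.1 * signb R y.2.1 + signb R x.2.2 * signb R y.2.2 =
  4^-1 * \sum_a rotated R a x * rotated R a y.
Proof.
case: x y => -[x1 x2] [x3 x4] [[y1 y2] [y3 y4]].
rewrite !big_ord_recl big_ord0 /rotated /=; by field.
Qed.

Definition replica_weight B (q : replicas) : R :=
  ising_weight g beta B (replica1 q) * ising_weight g beta B (replica2 q) *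
  ising_weight g beta B (replica3 q) * ising_weight g beta B (replica4 q).

Lemma replica_weightE B q : replica_weight B q =
  expR (\sum_(e <- g) \sum_a beta / 4 * (rotated R a (q e.1) * rotated R a (q e.2))) *
  expR (\sum_v B * rotated R ord0 (q v)).
Proof.
rewrite /replica_weight /ising_weight -!expRD; congr expR.
under [in RHS]eq_bigr do rewrite -mulr_sumr.
rewrite -!mulr_sumr -mulrA.
have -> : 4^-1 * (\sum_(e <- g) \sum_a rotated R a (q e.1) * rotated R a (q e.2)) =
  \sum_(e <- g) (spin R (replica1 q) e.1 * spin R (replica1 q) e.2 +
   spin R (replica2 q) e.1 * spin R (replica2 q) e.2 +
   spin R (replica3 q) e.1 * spin R (replica3 q) e.2 +
   spin R (replica4 q) e.1 * spin R (replica4 q) e.2).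
  rewrite mulr_sumr; apply: eq_bigr => e _; rewrite -rot_orthogonal.
  by rewrite /spin !ffunE.
have -> : \sum_v rotated R ord0 (q v) = total_spin R (replica1 q) +
    total_spin R (replica2 q) + total_spin R (replica3 q) + total_spin R (replica4 q).
  rewrite /total_spin -!big_split; apply: eq_bigr => v _ /=.
  by rewrite /spin !ffunE /rotated; case: (q v) => -[? ?] [? ?].
by rewrite !big_split /=; ring.
Qed.

Lemma rot_positive_expR_sum (I : Type) (r : seq I) (K : I -> 'I_N -> 'I_4 -> nat)
    (c : R) (f : replicas -> R) : 0 <= c -> rot_positive f ->
  rot_positive (fun q => f q * expR (\sum_(i <- r) c * rot_mono R (K i) q)).
Proof.
move=> c0; elim: r f => [|i r IH] f fpos.
  by move=> k; under eq_bigr do rewrite big_nil expR0 mulr1; exact: fpos.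
move=> k; under eq_bigr do rewrite big_cons expRD mulrA.
exact: IH (rot_positive_expR _ c0 fpos) k.
Qed.

Lemma replica_weight_positive B : 0 <= beta -> 0 <= B ->
  rot_positive (replica_weight B).
Proof.
move=> b0 B0.
pose Ke (p : ('I_N * 'I_N) * 'I_4) := fun v a =>
  (rot_exponent p.1.1 p.2 v a + rot_exponent p.1.2 p.2 v a)%N.
have c0 : 0 <= beta / 4 by rewrite divr_ge0.
have h1 := rot_positive_expR_sum [seq (e, a) | e <- g, a <- index_enum 'I_4]
  Ke c0 (@rot_positive1 R N).
have h2 := rot_positive_expR_sum (index_enum 'I_N)
  (fun v => rot_exponent v ord0) B0 h1.
move=> k; have := h2 k; congr (_ <= _); apply: eq_bigr => q _; congr (_ * _).
rewrite replica_weightE mul1r big_allpairs_dep/=; congr (expR _ * expR _).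
  apply: eq_bigr => e _; apply: eq_bigr => a _.
  by rewrite -rot_monoM !rot_mono1.
by apply: eq_bigr => v _; rewrite rot_mono1.
Qed.

(** The left-hand side is the third cumulant of the total spin times the cube
    of the partition function.  With T_1, T_2, T_3 the sums over the vertices of
    the rotated coordinates other than the first, the
    weighted sum of T_1 T_2 T_3 over independent replicas is - 4 Z times the
    left-hand side, Z being the partition function. *)
Lemma ghs_moments B : 0 <= beta -> 0 <= B ->
  spin_moment B 3 * spin_moment B 0 ^+ 2 -
    3 * spin_moment B 2 * spin_moment B 1 * spin_moment B 0 +
    2 * spin_moment B 1 ^+ 3 <= 0.
Proof.
move=> b0 B0; set m := spin_moment B.
pose W s1 s2 s3 s4 := let w := ising_weight g beta B in let S := @total_spin R N in
  w s1 * w s2 * w s3 * w s4 *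
   ((- S s1 - S s2 + S s3 + S s4) * (S s1 - S s2 + S s3 - S s4) *
    (S s1 - S s2 - S s3 + S s4)).
have pos : 0 <= \sum_s1 \sum_s2 \sum_s3 \sum_s4 W s1 s2 s3 s4.
  rewrite -sum_replicas.
  pose a1 : 'I_4 := lift ord0 ord0.
  pose a2 : 'I_4 := lift ord0 (lift ord0 ord0).
  pose a3 : 'I_4 := lift ord0 (lift ord0 (lift ord0 ord0)).
  have -> : \sum_q W (replica1 q) (replica2 q) (replica3 q) (replica4 q) =
     \sum_u \sum_v \sum_w \sum_q replica_weight B q *
       (rotated R a1 (q u) * rotated R a2 (q v) * rotated R a3 (q w)).
    under [RHS]eq_bigr do under eq_bigr do rewrite exchange_big.
    under [RHS]eq_bigr do rewrite exchange_big.
    rewrite exchange_big; apply: eq_bigr => q _ /=.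
    transitivity (replica_weight B q * ((\sum_u rotated R a1 (q u)) *
       (\sum_u rotated R a2 (q u)) * (\sum_u rotated R a3 (q u)))).
      rewrite /W; congr (_ * (_ * _ * _)); rewrite /total_spin -?sumrN -!big_split;
      apply: eq_bigr => v _; rewrite /spin !ffunE /rotated;
      by case: (q v) => -[? ?] [? ?].
    rewrite mulr_suml mulr_suml mulr_sumr; apply: eq_bigr => u _.
    rewrite -mulrA mulr_suml !mulr_sumr; apply: eq_bigr => v _.
    by rewrite !mulr_sumr; apply: eq_bigr => w _; rewrite !mulrA.
  apply: sumr_ge0 => u _; apply: sumr_ge0 => v _; apply: sumr_ge0 => w _.
  have := replica_weight_positive b0 B0 (fun x a => rot_exponent u a1 x a +
    rot_exponent v a2 x a + rot_exponent w a3 x a)%N.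
  congr (_ <= _); apply: eq_bigr => q _; congr (_ * _).
  by rewrite -rot_monoM -rot_monoM !rot_mono1.
have E : \sum_s1 \sum_s2 \sum_s3 \sum_s4 W s1 s2 s3 s4 =
   - (4 * m 0%N) * (m 3 * m 0%N ^+ 2 - 3 * m 2 * m 1 * m 0%N + 2 * m 1 ^+ 3).
  pose w := ising_weight g beta B; pose S := @total_spin R N.
  (* sum out the replicas one at a time, the product of the three rotated
     sums being a cubic polynomial in the spin of each of them *)
  have E4 s1 s2 s3 := @sum_cubic B (fun s4 => W s1 s2 s3 s4)
    (w s1 * w s2 * w s3 * (- S s1 ^+ 3 + S s1 ^+ 2 * S s2 + S s1 ^+ 2 * S s3
        + S s1 * S s2 ^+ 2 - S s2 ^+ 3 + S s2 ^+ 2 * S s3 - 2 * S s1 * S s2 * S s3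
        + S s2 * S s3 ^+ 2 + S s1 * S s3 ^+ 2 - S s3 ^+ 3))
    (w s1 * w s2 * w s3 * (S s1 ^+ 2 - 2 * S s1 * S s2 - 2 * S s1 * S s3
        + S s2 ^+ 2 - 2 * S s2 * S s3 + S s3 ^+ 2))
    (w s1 * w s2 * w s3 * (S s1 + S s2 + S s3))
    (w s1 * w s2 * w s3 * (-1)).
  have {}E4 s1 s2 s3 := E4 s1 s2 s3 (fun s4 => ltac:(rewrite /W -/w -/S; ring)).
  have E3 s1 s2 := @sum_cubic B (fun s3 => \sum_s4 W s1 s2 s3 s4)
    (w s1 * w s2 * (- S s1 ^+ 3 * m 0%N + S s1 ^+ 2 * S s2 * m 0%N + S s1 ^+ 2 * m 1
        - 2 * S s1 * S s2 * m 1 + S s1 * m 2 + S s1 * S s2 ^+ 2 * m 0%N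
        - S s2 ^+ 3 * m 0%N + S s2 ^+ 2 * m 1 + S s2 * m 2 - m 3))
    (w s1 * w s2 * (S s1 ^+ 2 * m 0%N - 2 * S s1 * m 1 + S s2 ^+ 2 * m 0%N
        - 2 * S s1 * S s2 * m 0%N - 2 * S s2 * m 1 + m 2))
    (w s1 * w s2 * (S s2 * m 0%N + S s1 * m 0%N + m 1))
    (w s1 * w s2 * (- m 0%N)).
  have {}E3 s1 s2 := E3 s1 s2 (fun s3 => ltac:(rewrite E4 -/m -/w -/S; ring)).
  have E2 s1 := @sum_cubic B (fun s2 => \sum_s3 \sum_s4 W s1 s2 s3 s4)
    (w s1 * (- S s1 ^+ 3 * m 0%N ^+ 2 + 2 * S s1 ^+ 2 * m 0%N * m 1
        - 2 * S s1 * m 1 ^+ 2 + 2 * S s1 * m 0%N * m 2 - 2 * m 0%N * m 3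
        + 2 * m 1 * m 2))
    (w s1 * (S s1 ^+ 2 * m 0%N ^+ 2 - 4 * S s1 * m 0%N * m 1 + 2 * m 0%N * m 2
        - 2 * m 1 ^+ 2))
    (w s1 * (S s1 * m 0%N ^+ 2 + 2 * m 0%N * m 1))
    (w s1 * (- m 0%N ^+ 2)).
  have {}E2 s1 := E2 s1 (fun s2 => ltac:(rewrite E3 -/m -/w -/S; ring)).
  have E1  := @sum_cubic B (fun s1 => \sum_s2 \sum_s3 \sum_s4 W s1 s2 s3 s4)
    (1 * (- 3 * m 0%N ^+ 2 * m 3 + 6 * m 0%N * m 1 * m 2 - 2 * m 1 ^+ 3))
    (1 * (- 6 * m 0%N * m 1 ^+ 2 + 3 * m 0%N ^+ 2 * m 2))
    (1 * (3 * m 0%N ^+ 2 * m 1))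
    (1 * (- m 0%N ^+ 3)).
  have {}E1  := E1  (fun s1 => ltac:(rewrite E2 -/m -/w -/S; ring)).
  by rewrite E1 -/m; ring.
move: pos; rewrite E mulNr oppr_ge0 pmulr_rle0// mulr_gt0//.
exact: spin_moment0_gt0.
Qed.

End SpinMoments.

(** * Variance of the total spin in a nonzero field *)

Section Variance.
Variables (R : realType) (N : nat) (g : multigraph N) (beta : R).
Notation m k B := (spin_moment g beta B k).

Definition mean_spin (B : R) : R := m 1 B / m 0 B.
Definition spin_variance (B : R) : R := m 2 B / m 0 B - mean_spin B ^+ 2.

Lemma is_derive_spin_moment (B : R) k :
  is_derive B 1 (fun b => m k b) (m k.+1 B).
Proof.
have -> : (fun b => m k b) =
    \sum_(s : config N) (fun b => ising_weight g beta b s * total_spin R s ^+ k).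
  by apply/funext => b; rewrite fct_sumE.
rewrite /spin_moment.
elim/big_ind2 : _ => [|x1 y1 x2 y2 h1 h2|s _]; first exact: is_derive_cst.
  exact: is_deriveD.
rewrite /ising_weight; set H := beta * _; set S := total_spin R s.
have hlin : is_derive B 1 (fun b : R => H + b * S) S.
  have h := is_deriveD (is_derive_cst H B 1)
    (is_deriveM (is_derive_id B 1) (is_derive_cst S B 1)).
  by apply: is_derive_eq h _; rewrite /= scaler0 !add0r /cst/= /GRing.scale/= mulr1.
have hexp := @is_derive1_comp R expR (fun b => H + b * S) B _ _ (is_derive_expR _) hlin.
have h := is_deriveM hexp (is_derive_cst (S ^+ k) B 1).
apply: is_derive_eq h _.
by rewrite /= /GRing.scale/= /cst/= exprS mulr0 add0r; ring.
Qed.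

Lemma is_derive_quotient (f h : R -> R) (x df dh : R) : h x != 0 ->
  is_derive x 1 f df -> is_derive x 1 h dh ->
  is_derive x 1 (fun y => f y / h y) ((df * h x - f x * dh) / h x ^+ 2).
Proof.
move=> hx fd hd.
apply: is_derive_eq (is_deriveM fd (is_deriveV hx hd)) _.
by rewrite /GRing.scale/=; field.
Qed.

Lemma is_derive_mean (B : R) : is_derive B 1 mean_spin (spin_variance B).
Proof.
have m0 : m 0 B != 0 by rewrite gt_eqF ?spin_moment0_gt0.
apply: is_derive_eq
  (is_derive_quotient m0 (is_derive_spin_moment B 1) (is_derive_spin_moment B 0)) _.
by rewrite /spin_variance /mean_spin; field.
Qed.

Lemma is_derive_variance (B : R) : is_derive B 1 spin_variance
  ((m 3 B * m 0 B ^+ 2 - 3 * m 2 B * m 1 B * m 0 B + 2 * m 1 B ^+ 3) / m 0 B ^+ 3).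
Proof.
have m0 : m 0 B != 0 by rewrite gt_eqF ?spin_moment0_gt0.
have h := is_deriveB
  (is_derive_quotient m0 (is_derive_spin_moment B 2) (is_derive_spin_moment B 0))
  (is_deriveX 2 (is_derive_mean B)).
apply: is_derive_eq h _.
by rewrite /spin_variance /mean_spin /GRing.scale/=; field.
Qed.

Lemma derive_continuous_within (f df : R -> R) (a b : R) :
  (forall x : R, is_derive x 1 f (df x)) -> {within `[a, b], continuous f}.
Proof.
move=> h; apply: continuous_subspaceT => x.
apply: differentiable_continuous; apply/derivable1_diffP.
by have [] := h x.
Qed.

(** The derivative of the variance is the third cumulant. *)
Lemma variance_nincr (B C : R) : 0 <= beta -> 0 <= B -> B < C ->
  spin_variance C <= spin_variance B.
Proof.
move=> b0 B0 BC.
have [x /[!in_itv]/= /andP[Bx xC] E] := MVT BC (fun x _ => is_derive_variance x)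
  (derive_continuous_within is_derive_variance).
rewrite -subr_le0 E pmulr_lle0 ?subr_gt0//.
rewrite pmulr_lle0 ?invr_gt0 ?exprn_gt0 ?spin_moment0_gt0//.
by apply: ghs_moments => //; lra.
Qed.

Lemma total_spin_le (s : config N) : `|total_spin R s| <= N%:R.
Proof.
rewrite /total_spin (le_trans (ler_norm_sum _ _ _))//.
rewrite -[leRHS]mulr1 -[N in leRHS]card_ord -sumr_const mulr_suml ler_sum// => i _.
by rewrite mul1r /spin; case: (s i); rewrite ?normrN normr1.
Qed.

Lemma mean_spin_le B : mean_spin B <= N%:R.
Proof.
rewrite /mean_spin ler_pdivrMr ?spin_moment0_gt0// /spin_moment mulr_sumr.
apply: ler_sum => s _; rewrite expr1 expr0 mulr1 mulrC ler_wpM2r ?expR_ge0//.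
exact: le_trans (ler_norm _) (total_spin_le s).
Qed.

Definition flip_all (s : config N) : config N := [ffun v => ~~ s v].

Lemma flip_allK : involutive flip_all.
Proof. by move=> s; apply/ffunP => v; rewrite !ffunE negbK. Qed.

Lemma spin_flip_all s v : spin R (flip_all s) v = - spin R s v.
Proof. by rewrite /spin ffunE; case: (s v); rewrite ?opprK. Qed.

Lemma total_spin_flip_all s : total_spin R (flip_all s) = - total_spin R s.
Proof. by rewrite -sumrN; apply: eq_bigr => v _; exact: spin_flip_all. Qed.

Lemma spin_momentN B k : m k (- B) = (-1) ^+ k * m k B.
Proof.
rewrite /spin_moment (reindex_inj (inv_inj flip_allK)) mulr_sumr.
apply: eq_bigr => s _; rewrite total_spin_flip_all (exprNn (total_spin R s)) mulrCA.
suff -> : ising_weight g beta (- B) (flip_all s) = ising_weight g beta B s by [].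
rewrite /ising_weight total_spin_flip_all mulrNN.
by under eq_bigr do rewrite !spin_flip_all mulrNN.
Qed.

Lemma mean_spin0 : mean_spin 0 = 0.
Proof.
have := spin_momentN 0 1; rewrite oppr0 expr1 mulN1r => /eqP.
by rewrite -addr_eq0 -mulr2n mulrn_eq0 /= => /eqP h; rewrite /mean_spin h mul0r.
Qed.

Lemma spin_varianceN B : spin_variance (- B) = spin_variance B.
Proof.
rewrite /spin_variance /mean_spin !spin_momentN expr0 expr1 (expr2 (-1)).
by rewrite mulrN1 opprK !mul1r mulN1r mulNr sqrrN.
Qed.

(** The mean of the total spin vanishes at field 0 and has slope equal to the
    variance, which is smallest at the right end of [0, B]. *)
Lemma spin_variance_le B : 0 <= beta -> B != 0 -> spin_variance B <= N%:R / `|B|.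
Proof.
move=> b0 Bn0; wlog B0 : B Bn0 / 0 < B => [hw|].
  have [|B0] := ltP 0 B; first exact: hw.
  rewrite -spin_varianceN -normrN; apply: hw; first by rewrite oppr_eq0.
  by rewrite oppr_gt0 lt_neqAle Bn0.
rewrite gtr0_norm// ler_pdivlMr//.
have [x /[!in_itv]/= /andP[Bx xC] E] := MVT B0 (fun x _ => is_derive_mean x)
  (derive_continuous_within is_derive_mean).
rewrite mean_spin0 !subr0 in E.
rewrite (le_trans _ (mean_spin_le B))// E ler_pM2r// variance_nincr//; lra.
Qed.

End Variance.

(** * Correlations at zero field *)

Section Correlations.
Variables (R : realType) (N : nat) (beta : R).
Implicit Types (g H : multigraph N) (l : seq 'I_N) (u j k : 'I_N).

Definition spin_prod l (s : config N) : R := \prod_(v <- l) spin R s v.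

Definition spin_corr_sum g l : R :=
  \sum_(s : config N) ising_weight g beta 0 s * spin_prod l s.

Definition correlation g u j : R :=
  spin_corr_sum g [:: u; j] / spin_corr_sum g [::].

(** The hyperbolic tangent of beta. *)
Definition tanh_ratio : R :=
  (expR beta - expR (- beta)) / (expR beta + expR (- beta)).

Let ch : R := (expR beta + expR (- beta)) / 2.
Let sh : R := (expR beta - expR (- beta)) / 2.

Lemma spin_sqr (s : config N) v : spin R s v * spin R s v = 1.
Proof. by rewrite /spin; case: (s v); rewrite ?mulrNN mulr1. Qed.

Lemma spin_norm (s : config N) v : `|spin R s v| = 1.
Proof. by rewrite /spin; case: (s v); rewrite ?normrN normr1. Qed.

Lemma ising_weight_cons e g (s : config N) : ising_weight (e :: g) beta 0 s =
  (ch + sh * (spin R s e.1 * spin R s e.2)) * ising_weight g beta 0 s.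
Proof.
rewrite /ising_weight big_cons mulrDr -addrA expRD; congr (_ * _).
by rewrite /ch /sh /spin; case: (s e.1); case: (s e.2);
  rewrite ?(mulrNN, mulrN, mulNr, mulr1); field.
Qed.

Lemma spin_corr_sum_cons e g l : spin_corr_sum (e :: g) l =
  ch * spin_corr_sum g l + sh * spin_corr_sum g (e.1 :: e.2 :: l).
Proof.
rewrite /spin_corr_sum !mulr_sumr -big_split; apply: eq_bigr => s _ /=.
by rewrite ising_weight_cons /spin_prod !big_cons; ring.
Qed.

(** The sum factorizes over the vertices into factors 0 or 2. *)
Lemma spin_prod_sum_ge0 l : 0 <= \sum_s spin_prod l s.
Proof.
have E s : spin_prod l s = \prod_v (if s v then 1 else - 1) ^+ count_mem v l.
  rewrite /spin_prod; elim: l => [|v l IH].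
    by rewrite big_nil big1// => v _; rewrite expr0.
  rewrite big_cons IH (bigD1 v)//= [in RHS](bigD1 v)//= eqxx exprS mulrA; congr (_ * _).
  by apply: eq_bigr => w wv; rewrite eq_sym (negPf wv).
under eq_bigr do rewrite E.
rewrite -(bigA_distr_bigA (fun v (b : bool) => (if b then 1 else - 1) ^+ count_mem v l)).
apply: prodr_ge0 => v _; rewrite big_bool/= expr1n -signr_odd.
by case: odd; rewrite ?expr0 ?expr1; lra.
Qed.

Hypothesis beta_ge0 : 0 <= beta.

Lemma ch_gt0 : 0 < ch.
Proof. by rewrite divr_gt0// addr_gt0// expR_gt0. Qed.

Lemma sh_ge0 : 0 <= sh.
Proof. by rewrite divr_ge0// subr_ge0 ler_expR (le_trans _ beta_ge0)// oppr_le0. Qed.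

Lemma tanh_ratioE : tanh_ratio = sh / ch.
Proof.
rewrite /tanh_ratio /sh /ch.
have : expR beta + expR (- beta) != 0 by rewrite gt_eqF// addr_gt0// expR_gt0.
by move=> h; field.
Qed.

Lemma tanh_ratio_ge0 : 0 <= tanh_ratio.
Proof. by rewrite tanh_ratioE divr_ge0 ?sh_ge0// ltW ?ch_gt0. Qed.

(** Griffiths' first inequality: the weight of each edge is a positive
    combination of 1 and of the product of its two spins, so that everything
    reduces to uniform spins. *)
Lemma griffiths g l : 0 <= spin_corr_sum g l.
Proof.
elim: g l => [|e g IH] l.
  rewrite /spin_corr_sum /ising_weight.
  under eq_bigr do rewrite big_nil mulr0 mul0r addr0 expR0 mul1r.
  exact: spin_prod_sum_ge0.
rewrite spin_corr_sum_cons addr_ge0// mulr_ge0 ?sh_ge0//.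
by rewrite ltW ?ch_gt0.
Qed.

Lemma spin_corr_sum_nilE g : spin_corr_sum g [::] = partition_function g beta 0.
Proof. by apply: eq_bigr => s _; rewrite /spin_prod big_nil mulr1. Qed.

Lemma spin_corr_sum_nil_gt0 g : 0 < spin_corr_sum g [::].
Proof. by rewrite spin_corr_sum_nilE partition_function_gt0. Qed.

Lemma correlation_ge0 g u j : 0 <= correlation g u j.
Proof. by rewrite divr_ge0// ?griffiths// ltW// spin_corr_sum_nil_gt0. Qed.

Lemma correlation_le1 g u j : correlation g u j <= 1.
Proof.
rewrite ler_pdivrMr ?spin_corr_sum_nil_gt0// mul1r ler_sum// => s _.
rewrite ler_wpM2l ?expR_ge0// /spin_prod !big_cons !big_nil !mulr1.
by rewrite (le_trans (ler_norm _))// normrM !spin_norm mulr1.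
Qed.

Lemma perm_spin_corr_sum g H l : perm_eq g H -> spin_corr_sum g l = spin_corr_sum H l.
Proof.
by move=> gH; apply: eq_bigr => s _; rewrite /ising_weight (perm_big _ gH).
Qed.

(** With the edge expanded as cosh + sinh s_u s_k, the numerator on the left is
    exactly that of the right-hand side, and the denominator can only be larger
    than cosh times the partition function without the edge. *)
Lemma correlation_edge g e u k j : e \in g -> e = (u, k) \/ e = (k, u) ->
  correlation g u j <=
    correlation (rem e g) u j + tanh_ratio * correlation (rem e g) k j.
Proof.
move=> eg ek; set g' := rem e g.
have E l : spin_corr_sum g l = spin_corr_sum (e :: g') l.
  exact/perm_spin_corr_sum/perm_to_rem.
have W0 := spin_corr_sum_nil_gt0 g'; have c0 := ch_gt0; have s0 := sh_ge0.
rewrite /correlation !E !spin_corr_sum_cons.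
have -> : spin_corr_sum g' [:: e.1; e.2; u; j] = spin_corr_sum g' [:: k; j].
  apply: eq_bigr => s _; congr (_ * _); rewrite /spin_prod !big_cons !big_nil.
  transitivity (spin R s u * spin R s u * (spin R s k * (spin R s j * 1))).
    by case: ek => -> /=; ring.
  by rewrite spin_sqr mul1r.
have G1 := griffiths g' [:: u; j]; have G2 := griffiths g' [:: k; j].
have G3 := griffiths g' [:: e.1; e.2].
apply: (@le_trans _ _ ((ch * spin_corr_sum g' [:: u; j] + sh * spin_corr_sum g' [:: k; j])
    / (ch * spin_corr_sum g' [::]))).
  have num_ge0 : 0 <= ch * spin_corr_sum g' [:: u; j] + sh * spin_corr_sum g' [:: k; j].
    by rewrite addr_ge0// mulr_ge0// ltW.
  have den_gt0 : 0 < ch * spin_corr_sum g' [::] by rewrite mulr_gt0.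
  have add_ge0 : 0 <= sh * spin_corr_sum g' [:: e.1; e.2] by rewrite mulr_ge0.
  by rewrite ler_wpM2l// lef_pV2 ?posrE ?lerDl// ltr_pwDl.
rewrite tanh_ratioE le_eqVlt; apply/orP; left; apply/eqP.
by field; rewrite !gt_eqF.
Qed.

Lemma edge_multC g u k : edge_mult g u k = edge_mult g k u.
Proof. by apply: eq_count => e /=; rewrite orbC. Qed.

Lemma edge_mult_rem g e u k : e \in g -> e = (u, k) \/ e = (k, u) ->
  edge_mult g u k = (edge_mult (rem e g) u k).+1.
Proof.
move=> eg ek; rewrite /edge_mult (permP (perm_to_rem eg))/=.
by case: ek => ->; rewrite eqxx ?orbT.
Qed.

Lemma edge_mult_rem_le g e u k : (edge_mult (rem e g) u k <= edge_mult g u k)%N.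
Proof.
have [eg|eg] := boolP (e \in g); last by rewrite rem_id.
by rewrite /edge_mult [leqRHS](permP (perm_to_rem eg))/= leq_addl.
Qed.

Lemma adjacentP g u k : Defs.adjacent g u k ->
  exists2 e, e \in g & e = (u, k) \/ e = (k, u).
Proof.
rewrite /Defs.adjacent -has_count => /hasP[e eg /orP[] /eqP ek].
  by exists e; last left.
by exists e; last right.
Qed.

(** Flipping the spin at an isolated vertex preserves the weight. *)
Lemma correlation_isolated g u j : u != j -> (forall k, ~~ Defs.adjacent g u k) ->
  correlation g u j = 0.
Proof.
move=> uj iso; rewrite /correlation.
suff -> : spin_corr_sum g [:: u; j] = 0 by rewrite mul0r.
pose fl (s : config N) : config N := [ffun v => if v == u then ~~ s v else s v].
have flK : involutive fl.
  by move=> s; apply/ffunP => v; rewrite !ffunE; case: eqP => // _; rewrite negbK.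
have flE s v : spin R (fl s) v = if v == u then - spin R s v else spin R s v.
  by rewrite /spin ffunE; case: eqP => // _; case: (s v); rewrite ?opprK.
apply/eqP; rewrite -[_ == 0](mulrn_eq0 _ 2) mulr2n addr_eq0 -sumrN.
apply/eqP; rewrite [LHS](reindex_inj (inv_inj flK)); apply: eq_bigr => s _.
have -> : ising_weight g beta 0 (fl s) = ising_weight g beta 0 s.
  rewrite /ising_weight !mul0r.
  suff -> : \sum_(e <- g) spin R (fl s) e.1 * spin R (fl s) e.2 =
      \sum_(e <- g) spin R s e.1 * spin R s e.2 by [].
  apply: eq_big_seq => -[a b] eg /=; rewrite !flE.
  have a_u : a != u.
    apply: contra (iso b) => /eqP <-; rewrite /Defs.adjacent -has_count.
    by apply/hasP; exists (a, b) => //=; rewrite eqxx.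
  have b_u : b != u.
    apply: contra (iso a) => /eqP <-; rewrite /Defs.adjacent -has_count.
    by apply/hasP; exists (a, b) => //=; rewrite eqxx orbT.
  by rewrite (negPf a_u) (negPf b_u).
rewrite /spin_prod !big_cons big_nil !flE eqxx eq_sym (negPf uj).
by rewrite big_nil mulNr mulrN.
Qed.

(** Removing the edges at u one after the other: once they are all gone, u is
    isolated, and the removal of the edge to child c costs tanh beta times a
    correlation in a subgraph where that edge is missing.  The bounds b are
    required for all such subgraphs because the order of the removals decides
    which other edges at u are still present. *)
Lemma correlation_star H u j (L : seq nat) (child : nat -> 'I_N) (b : nat -> R) :
  u != j ->
  (forall k, Defs.adjacent H u k -> exists2 c, c \in L & k = child c) ->
  (forall c, c \in L -> (edge_mult H u (child c) <= 1)%N) ->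
  (forall c, c \in L -> 0 <= b c) ->
  (forall c H', c \in L -> (forall x y, (edge_mult H' x y <= edge_mult H x y)%N) ->
     ~~ Defs.adjacent H' u (child c) -> correlation H' (child c) j <= b c) ->
  correlation H u j <= tanh_ratio * \sum_(c <- L) b c.
Proof.
move=> uj; elim: L H => [|c L IH] H nbr m1 b0 bound.
  rewrite big_nil mulr0 correlation_isolated// => k.
  by apply/negP => /nbr[].
rewrite big_cons.
have [adj|nadj] := boolP (Defs.adjacent H u (child c)); last first.
  rewrite (@le_trans _ _ (tanh_ratio * \sum_(c <- L) b c))//.
    apply: IH => [k uk|d dL|d dL|d H' dL]; last 3 first.
    - by apply: m1; rewrite inE dL orbT.
    - by apply: b0; rewrite inE dL orbT.
    - by apply: bound; rewrite inE dL orbT.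
    have [d /[!inE]/orP[/eqP ->|dL] kd] := nbr k uk; last by exists d.
    by move: uk nadj; rewrite kd => ->.
  by rewrite ler_wpM2l ?tanh_ratio_ge0// lerDr b0 ?mem_head.
have [e eH ec] := adjacentP adj.
apply: le_trans (correlation_edge j eH ec) _; rewrite mulrDr addrC lerD//.
  rewrite ler_wpM2l ?tanh_ratio_ge0// bound ?mem_head//.
    by move=> x y; exact: edge_mult_rem_le.
  have := m1 c (mem_head _ _); rewrite (edge_mult_rem eH ec) /Defs.adjacent.
  by case: edge_mult.
have nadj : ~~ Defs.adjacent (rem e H) u (child c).
  have := m1 c (mem_head _ _); rewrite (edge_mult_rem eH ec) /Defs.adjacent.
  by case: edge_mult.
apply: IH => [k uk|d dL|d dL|d H' dL H'H].
- have uk' : Defs.adjacent H u k by apply: leq_trans uk (edge_mult_rem_le _ _ _ _).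
  have [d /[!inE]/orP[/eqP ->|dL] kd] := nbr k uk'; last by exists d.
  by move: uk nadj; rewrite kd => ->.
- by rewrite (leq_trans (edge_mult_rem_le _ _ _ _))// m1// inE dL orbT.
- by apply: b0; rewrite inE dL orbT.
- apply: bound; first by rewrite inE dL orbT.
  by move=> x y; apply: leq_trans (H'H x y) (edge_mult_rem_le _ _ _ _).
Qed.

End Correlations.

(** * Correlations across a ball which is a tree *)

Lemma spin_variance0 (R : realType) N (g : multigraph N) (beta : R) :
  spin_variance g beta 0 = \sum_u \sum_j correlation beta g u j.
Proof.
rewrite /spin_variance mean_spin0 expr0n subr0 /correlation.
under eq_bigr do rewrite -mulr_suml.
rewrite -mulr_suml spin_corr_sum_nilE partition_functionE; congr (_ / _).
under eq_bigr do rewrite exchange_big/=.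
rewrite exchange_big; apply: eq_bigr => s _ /=.
rewrite expr2 /total_spin mulr_suml mulr_sumr; apply: eq_bigr => u _.
rewrite !mulr_sumr; apply: eq_bigr => j _.
by rewrite /spin_prod !big_cons big_nil mulr1.
Qed.

Section PlaneTrees.
Local Open Scope nat_scope.

Fixpoint subtree (T : ptree) (a : seq nat) : ptree :=
  if a is k :: a' then subtree (nth (PNode [::]) (children T) k) a' else T.

Fixpoint generation_size (h : nat) (T : ptree) : nat :=
  if h is h'.+1 then \sum_(T' <- children T) generation_size h' T' else 1.

Fixpoint node_list (h : nat) (T : ptree) : seq (seq nat) :=
  [::] :: (if h is h'.+1 then
    flatten [seq [seq k :: a | a <- node_list h' (nth (PNode [::]) (children T) k)]
            | k <- iota 0 (size (children T))]
  else [::]).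

Lemma mem_node_list h T a : is_node T a -> size a <= h -> a \in node_list h T.
Proof.
elim: h T a => [|h IH] T [|k a] //=.
case/andP => kT aT ah; rewrite inE; apply/orP; right.
apply/flattenP; exists [seq k :: b | b <- node_list h (nth (PNode [::]) (children T) k)].
  by apply/mapP; exists k => //; rewrite mem_iota.
by apply: map_f; exact: IH.
Qed.

Lemma is_node_cat T a b : is_node T (a ++ b) = is_node T a && is_node (subtree T a) b.
Proof. by elim: a T => //= k a IH T; rewrite IH andbA. Qed.

Lemma subtree_cat T a b : subtree T (a ++ b) = subtree (subtree T a) b.
Proof. by elim: a T => //= k a IH T; rewrite IH. Qed.

Lemma is_node_rcons T a c :
  is_node T (rcons a c) = is_node T a && (c < size (children (subtree T a))).
Proof. by rewrite -cats1 is_node_cat /= andbT. Qed.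

Lemma is_parent_rcons a c : is_parent a (rcons a c).
Proof.
rewrite /is_parent size_rcons /= -cats1 take_size_cat//.
by case: a => //= k a; rewrite eqxx.
Qed.

Lemma is_parentP a b : is_parent a b -> exists c, b = rcons a c.
Proof.
case: (lastP b) => [//|b' c] /andP[_]; rewrite size_rcons /= -cats1 take_size_cat//.
by move/eqP => ->; exists c; rewrite cats1.
Qed.

End PlaneTrees.

Section TreeBall.
Variables (R : realType) (beta : R).
Hypothesis beta_ge0 : 0 <= beta.
Variables (N : nat) (g : multigraph N) (i : 'I_N) (t : nat) (T : ptree).

Lemma dist_le_step s u k : dist_le g s i u -> Defs.adjacent g u k -> dist_le g s.+1 i k.
Proof.
move=> [q [qs pq lq]] uk; exists (rcons q k); split.
- by rewrite size_rcons.
- by rewrite rcons_path pq lq.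
- by rewrite last_rcons.
Qed.

Lemma dist_leW s s' u : (s <= s')%N -> dist_le g s i u -> dist_le g s' i u.
Proof. by move=> ss' [q [qs pq lq]]; exists q; split=> //; exact: leq_trans ss'. Qed.

Variable f : 'I_N -> seq nat.
Let V := [set j | dist_le g t i j].
Hypothesis f_bij : set_bij V [set a | is_node T a] f.
Hypothesis f_root : f i = [::].
Hypothesis f_mult : forall x y, V x -> V y ->
  (is_parent (f x) (f y) || is_parent (f y) (f x) : nat) = edge_mult g x y.

Lemma ball_center : V i.
Proof. by exists [::]. Qed.

Lemma ball_preimage a : is_node T a -> exists2 x, V x & f x = a.
Proof. by case: f_bij => _ _ /[apply] -[x Vx fx]; exists x. Qed.

Lemma ball_inj x y : V x -> V y -> f x = f y -> x = y.
Proof. by move=> Vx Vy; case: f_bij => _ fi _; apply: fi; rewrite inE. Qed.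

(** The path from the root to an address, pulled back to the graph. *)
Lemma ball_depth a x : V x -> f x = a -> is_node T a -> dist_le g (size a) i x.
Proof.
elim/last_ind: a x => [|a c IH] x Vx fx.
  move=> _; have -> : x = i by apply: ball_inj => //; [exact: ball_center|rewrite f_root].
  by exists [::].
rewrite is_node_rcons => /andP[aT _]; have [y Vy fy] := ball_preimage aT.
rewrite size_rcons; apply: dist_le_step (IH _ Vy fy aT) _.
by rewrite /Defs.adjacent -f_mult// fx fy is_parent_rcons.
Qed.

(** Induction on the number h of generations that separate u from the boundary
    of the ball.  The edge from u to its parent is assumed to be missing in H,
    so that u is only connected to its children; this is the state in which the
    recursion leaves a child, because its edge to u has been deleted. *)
Lemma ball_correlation_le h a u H j : V u -> f u = a -> is_node T a ->
  (size a + h)%N = t -> ~ V j ->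
  (forall x y, (edge_mult H x y <= edge_mult g x y)%N) ->
  (forall x, V x -> is_parent (f x) a -> ~~ Defs.adjacent H u x) ->
  correlation beta H u j <=
    (generation_size h (subtree T a))%:R * tanh_ratio beta ^+ h.
Proof.
elim: h a u H => [|h IH] a u H Vu fu aT ah Vj Hg nopar.
  by rewrite expr0 mul1r correlation_le1.
set T' := subtree T a.
pose child c := xget i [set x | V x /\ f x = rcons a c].
have childP c : (c < size (children T'))%N -> V (child c) /\ f (child c) = rcons a c.
  move=> cT; have [x Vx fx] : exists2 x, V x & f x = rcons a c.
    by apply: ball_preimage; rewrite is_node_rcons aT.
  exact: (@xgetPex _ i [set x | V x /\ f x = rcons a c] (ex_intro _ x (conj Vx fx))).
have at_ : (size a < t)%N by rewrite -ah addnS ltnS leq_addr.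
pose b c :=
  (generation_size h (nth (PNode [::]) (children T') c))%:R * tanh_ratio beta ^+ h.
have -> : (generation_size h.+1 T')%:R * tanh_ratio beta ^+ h.+1 =
    tanh_ratio beta * \sum_(c <- index_iota 0 (size (children T'))) b c.
  rewrite /= (big_nth (PNode [::])) natr_sum exprS mulrCA; congr (_ * _).
  by rewrite mulr_suml.
have uj : u != j by apply/eqP => uj; apply: Vj; rewrite -uj.
apply: (@correlation_star _ _ _ beta_ge0 _ _ _ _ child) => //.
- move=> k uk; have gk : Defs.adjacent g u k by apply: leq_trans uk (Hg _ _).
  have Vk : V k.
    by apply: dist_leW at_ _; apply: dist_le_step gk; exact: ball_depth fu aT.
  have kT : is_node T (f k) by case: f_bij => /(_ _ Vk).
  have := gk; rewrite /Defs.adjacent -f_mult// lt0b => /orP[]; rewrite fu.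
    move/is_parentP => [c fk]; move: kT; rewrite fk is_node_rcons => /andP[_ cT].
    exists c; first by rewrite mem_index_iota.
    have [Vc fc] := childP c cT.
    by apply: ball_inj => //; rewrite fc.
  by move=> pk; move: (nopar k Vk pk); rewrite uk.
- move=> c; rewrite mem_index_iota/= => /childP[Vc fc].
  by rewrite (leq_trans (Hg _ _))// -f_mult// leq_b1.
- by move=> c _; rewrite /b mulr_ge0// exprn_ge0// tanh_ratio_ge0.
- move=> c H'; rewrite mem_index_iota/= => cT H'H nadj; have [Vc fc] := childP c cT.
  rewrite /b -[nth _ _ _]/(subtree T' [:: c]) -subtree_cat cats1.
  apply: IH => //.
  + by rewrite is_node_rcons aT.
  + by rewrite size_rcons addSnnS.
  + by move=> x y; rewrite (leq_trans (H'H x y)).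
  + move=> x Vx /is_parentP[d] /rcons_inj[fx _].
    rewrite (_ : x = u); last by apply: ball_inj => //; rewrite fu.
    by rewrite /Defs.adjacent edge_multC.
Qed.

(** Correlations inside the ball are bounded by 1, those outside by delta. *)
Lemma ball_row_sum_le (delta : R) : has_generations t T ->
  (generation_size t T)%:R * tanh_ratio beta ^+ t <= delta ->
  \sum_j correlation beta g i j <= (size (node_list t T))%:R + N%:R * delta.
Proof.
move=> Tt Td.
have d0 : 0 <= delta by apply: le_trans Td; rewrite mulr_ge0// exprn_ge0// tanh_ratio_ge0.
rewrite (bigID (fun j => `[< V j >]))/= lerD//.
  apply: (@le_trans _ _ (\sum_(j | `[< V j >]) 1)).
    by apply: ler_sum => j _; exact: correlation_le1.
  rewrite sumr_const ler_nat cardE -(size_map f); apply: uniq_leq_size.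
    rewrite map_inj_in_uniq ?enum_uniq// => x y.
    rewrite !mem_enum => /asboolP Vx /asboolP Vy; exact: ball_inj.
  move=> a /mapP[x]; rewrite mem_enum => /asboolP Vx ->.
  have xT : is_node T (f x) by case: f_bij => /(_ _ Vx).
  by apply: mem_node_list => //; exact: Tt.
apply: (@le_trans _ _ (\sum_(j | ~~ `[< V j >]) delta)).
  apply: ler_sum => j /asboolPn Vj; apply: le_trans Td.
  apply: (@ball_correlation_le t [::]) => //; exact: ball_center.
rewrite sumr_const -(mulr_natl delta) ler_wpM2r// ler_nat.
by rewrite -[leqRHS]card_ord max_card.
Qed.

End TreeBall.

(** * Typical trees of the branching process *)

Section TreeEnumeration.

Fixpoint forests (n : nat) (L : seq ptree) : seq (seq ptree) :=
  if n is n'.+1 then [seq T :: s | T <- L, s <- forests n' L] else [:: [::]].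

(** With offspring numbers below K there is a finite list of trees, in which the
    branching process is described by finite sums. *)
Fixpoint trees (K t : nat) : seq ptree :=
  if t is t'.+1 then [seq PNode s | n <- iota 0 K, s <- forests n (trees K t')]
  else [:: PNode [::]].

Lemma forestsP n L s : s \in forests n L -> size s = n /\ {subset s <= L}.
Proof.
elim: n s => [|n IH] s /=; first by rewrite inE => /eqP ->.
move/allpairsP => [[T s'] /= [TL /IH[<- s'L] ->]]; split=> // T'.
by rewrite inE => /orP[/eqP ->|/s'L].
Qed.

Lemma forests_uniq n L : uniq L -> uniq (forests n L).
Proof.
move=> uL; elim: n => //= n IH; apply: allpairs_uniq => //.
by move=> [T s] [T' s'] _ _ /= [-> ->].
Qed.

Lemma trees_uniq K t : uniq (trees K t).
Proof.
elim: t => //= t IH; apply: allpairs_uniq_dep; first exact: iota_uniq.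
  by move=> n _; exact: forests_uniq.
move=> [n s] [n' s'] /allpairsPdep[m [r [_ /forestsP[<- _] /= [-> ->]]]].
move=> /allpairsPdep[m' [r' [_ /forestsP[<- _] /= [-> ->]]]] [rr].
by rewrite rr.
Qed.

Lemma trees_has_generations K t T : T \in trees K t -> has_generations t T.
Proof.
elim: t T => [|t IH] T /=; first by rewrite inE => /eqP -> [|k u].
move=> /allpairsPdep[m [s [_ /forestsP[_ sL] ->]]] [|k u] //= /andP[ks].
by apply: IH; apply: sL; exact: mem_nth.
Qed.

Variables (R : realType).

Lemma sum_forests n L (F : ptree -> R) :
  \sum_(s <- forests n L) \prod_(T <- s) F T = (\sum_(T <- L) F T) ^+ n.
Proof.
elim: n => [|n IH] /=; first by rewrite big_seq1 big_nil.
rewrite big_allpairs_dep/= exprS mulr_suml; apply: eq_bigr => T _.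
by rewrite -IH mulr_sumr; apply: eq_bigr => s _; rewrite big_cons.
Qed.

(** Differentiating sum_forests: one of the n trees carries the weight G. *)
Lemma sum_forests_weighted n L (F G : ptree -> R) :
  \sum_(s <- forests n L) \prod_(T <- s) F T * \sum_(T <- s) G T =
  n%:R * (\sum_(T <- L) F T) ^+ n.-1 * \sum_(T <- L) F T * G T.
Proof.
elim: n => [|n IH] /=; first by rewrite big_seq1 !big_nil mulr0 !mul0r.
rewrite big_allpairs_dep/=.
transitivity (\sum_(T <- L) (F T * G T * (\sum_(T <- L) F T) ^+ n +
  F T * (n%:R * (\sum_(T <- L) F T) ^+ n.-1 * \sum_(T <- L) F T * G T))).
  apply: eq_bigr => T _; rewrite -IH -sum_forests !mulr_sumr -big_split.
  by apply: eq_bigr => s _ /=; rewrite !big_cons; ring.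
rewrite big_split/= -!mulr_suml.
by case: n IH => [|n] _ /=; [ring|rewrite -(natr1 n.+1) exprS; ring].
Qed.

Section Mass.
Variable rho : nat -> R.

Definition tree_total (q : nat -> R) (K t : nat) : R :=
  \sum_(T <- trees K t) branching_mass rho q t T.

Definition generation_total (q : nat -> R) (K t : nat) : R :=
  \sum_(T <- trees K t) branching_mass rho q t T * (generation_size t T)%:R.

Lemma sum_treesS K t (F : ptree -> R) : \sum_(T <- trees K t.+1) F T =
  \sum_(0 <= n < K) \sum_(s <- forests n (trees K t)) F (PNode s).
Proof. by rewrite /= big_allpairs_dep /index_iota subn0. Qed.

Lemma tree_totalS q K t :
  tree_total q K t.+1 = \sum_(0 <= n < K) q n * tree_total rho K t ^+ n.
Proof.
rewrite /tree_total sum_treesS; apply: eq_bigr => n _.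
rewrite -sum_forests mulr_sumr; apply: eq_big_seq => s /forestsP[sn _] /=.
by rewrite sn.
Qed.

Lemma generation_totalS q K t : generation_total q K t.+1 =
  (\sum_(0 <= n < K) n%:R * q n * tree_total rho K t ^+ n.-1) *
    generation_total rho K t.
Proof.
rewrite /generation_total sum_treesS mulr_suml; apply: eq_bigr => n _.
have := sum_forests_weighted n (trees K t) (branching_mass rho rho t)
  (fun T => (generation_size t T)%:R).
rewrite -[\sum_(T <- trees K t) branching_mass rho rho t T]/(tree_total rho K t).
set S := \sum_(T <- trees K t) _ => E.
transitivity (q n * (n%:R * tree_total rho K t ^+ n.-1 * S)); last by ring.
rewrite -E mulr_sumr; apply: eq_big_seq => s /forestsP[sn _] /=.
by rewrite sn natr_sum mulrA.
Qed.

Definition probability_law (q : nat -> R) : Prop :=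
  [/\ forall n, 0 <= q n, forall K, \sum_(0 <= n < K) q n <= 1 &
    forall d, 0 < d -> exists K, 1 - d <= \sum_(0 <= n < K) q n].

Hypothesis rho_law : probability_law rho.

Lemma branching_mass_ge0 q t T : (forall n, 0 <= q n) -> 0 <= branching_mass rho q t T.
Proof.
have [rho0 _ _] := rho_law.
elim: t q T => [|t IH] q [s] q0 /=; first by rewrite ler0n.
by rewrite mulr_ge0// prodr_ge0// => T _; exact: IH.
Qed.

Lemma tree_total_ge0 q K t : (forall n, 0 <= q n) -> 0 <= tree_total q K t.
Proof. by move=> q0; apply: sumr_ge0 => T _; exact: branching_mass_ge0. Qed.

Lemma tree_total_le1 q K t : probability_law q -> tree_total q K t <= 1.
Proof.
elim: t q => [|t IH] q [q0 q1 _].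
  by rewrite /tree_total /= big_seq1.
have [rho0 _ _] := rho_law.
rewrite tree_totalS (le_trans _ (q1 K))// ler_sum// => n _.
by rewrite ler_piMr// exprn_ile1 ?tree_total_ge0 ?IH.
Qed.

(** The truncation of the offspring numbers is harmless: if the subtrees have
    total mass x, the trees have total mass the generating function at x, which
    tends to 1 with x. *)
Lemma tree_total_cvg q t d : probability_law q -> 0 < d ->
  exists K0, forall K, (K0 <= K)%N -> 1 - d <= tree_total q K t.
Proof.
elim: t q d => [|t IH] q d qlaw d0.
  by exists 0%N => K _; rewrite /tree_total/= big_seq1/=; lra.
have [q0 q1 /(_ (d / 2) ltac:(by rewrite divr_gt0))[K1 hK1]] := qlaw.
(* chosen so that K1 (1 - x) <= d / 2 when x >= 1 - d', which makes
   Bernoulli's inequality give x ^+ n >= 1 - d / 2 for all n < K1 *)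
pose d' := d / (2 * K1.+1%:R).
have d'0 : 0 < d' by rewrite divr_gt0// mulr_gt0// ltr0n.
have [K2 hK2] := IH rho d' rho_law d'0.
exists (maxn K1 K2) => K; rewrite geq_max => /andP[K1K /hK2].
rewrite tree_totalS; set x := tree_total rho K t => x1.
have [rho0 _ _] := rho_law.
have x0 : 0 <= x by apply: tree_total_ge0.
have xle1 : x <= 1 by apply: tree_total_le1.
have bern n : 1 - n%:R * (1 - x) <= x ^+ n.
  elim: n => [|n IHn]; first by rewrite mul0r subr0 expr0.
  rewrite exprS.
  have : 0 <= x * (x ^+ n - (1 - n%:R * (1 - x))) by rewrite mulr_ge0// subr_ge0.
  have : 0 <= n%:R * (1 - x) ^+ 2 by rewrite mulr_ge0// sqr_ge0.
  rewrite -natr1; nra.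
rewrite (big_cat_nat (n := K1))//=.
have tail : 0 <= \sum_(K1 <= n < K) q n * x ^+ n.
  by apply: sumr_ge0 => n _; rewrite mulr_ge0// exprn_ge0.
have head : (1 - d / 2) * (\sum_(0 <= n < K1) q n) <= \sum_(0 <= n < K1) q n * x ^+ n.
  rewrite mulr_sumr !big_mkord ler_sum// => n _; rewrite mulrC ler_wpM2l//.
  apply: le_trans (bern n).
  have : n%:R * (1 - x) <= K1.+1%:R * d'.
    rewrite ler_pM ?ler0n ?subr_ge0 ?ler_nat ?leqW// ?(ltnW (ltn_ord n))//; lra.
  have -> : K1.+1%:R * d' = d / 2.
    have : K1.+1%:R != 0 :> R by rewrite pnatr_eq0.
    by rewrite /d'; move: K1.+1%:R => x' x'0; field.
  lra.
have := q1 K1; move: hK1 head tail; set Q := \sum_(0 <= n < K1) q n => *.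
nra.
Qed.

(** Each generation multiplies the mean size by the mean offspring number; the
    truncation only decreases it. *)
Lemma generation_total_le q (mq mrho : R) K t : probability_law q ->
  0 <= mrho ->
  (forall K, \sum_(0 <= n < K) n%:R * q n <= mq) ->
  (forall K, \sum_(0 <= n < K) n%:R * rho n <= mrho) ->
  generation_total q K t.+1 <= mq * mrho ^+ t.
Proof.
move=> qlaw mr0 hq hrho.
have [rho0 _ _] := rho_law.
have gt_ge0 t' : 0 <= generation_total rho K t'.
  by apply: sumr_ge0 => T _; rewrite mulr_ge0// branching_mass_ge0.
have step q' m t' : probability_law q' ->
    (forall K, \sum_(0 <= n < K) n%:R * q' n <= m) ->
    generation_total q' K t'.+1 <= m * generation_total rho K t'.
  move=> [q'0 _ _] hm; rewrite generation_totalS ler_wpM2r//.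
  apply: le_trans (hm K); apply: ler_sum => n _.
  by rewrite ler_piMr ?mulr_ge0// exprn_ile1 ?tree_total_ge0 ?tree_total_le1.
elim: t q mq qlaw hq => [|t IH] q mq qlaw hq.
  apply: le_trans (step _ _ _ qlaw hq) _.
  by rewrite /generation_total/= big_seq1/= mulr1.
have mq0 : 0 <= mq by have := hq 0%N; rewrite big_nil.
apply: le_trans (step _ _ _ qlaw hq) _.
by rewrite exprS ler_wpM2l//; exact: IH.
Qed.

(** Trees with a large last generation are discarded by Markov's inequality. *)
Lemma typical_trees q (mq mrho theta delta : R) : probability_law q ->
  0 <= mrho -> 0 <= theta -> mrho * theta < 1 -> 0 < delta ->
  (forall K, \sum_(0 <= n < K) n%:R * q n <= mq) ->
  (forall K, \sum_(0 <= n < K) n%:R * rho n <= mrho) ->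
  exists t (A : seq ptree), [/\ uniq A,
    forall T, T \in A -> has_generations t T /\
      (generation_size t T)%:R * theta ^+ t <= delta &
    1 - delta <= \sum_(T <- A) branching_mass rho q t T].
Proof.
move=> qlaw mr0 th0 mth1 d0 hq hrho.
have mq0 : 0 <= mq by have := hq 0%N; rewrite big_nil.
have [q0 _ _] := qlaw.
(* Markov divides the bound delta * (delta / 2) on the mean by delta; the
   other delta / 2 pays for the truncation *)
have [t ht] : exists t, mq * mrho ^+ t * theta ^+ t.+1 <= delta * (delta / 2).
  have cvg0 : (mq * theta) * (mrho * theta) ^+ n @[n --> \oo] --> (mq * theta) * 0.
    apply: cvgMl_tmp; apply: cvg_expr; rewrite ger0_norm// mulr_ge0//.
  have e0 : 0 < delta * (delta / 2) by rewrite mulr_gt0// divr_gt0.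
  move/cvgrPdist_le: cvg0 => /(_ _ e0)[t _ /(_ t (leqnn t))] /=.
  rewrite mulr0 sub0r normrN => h; exists t; apply: le_trans h.
  by rewrite (le_trans _ (ler_norm _))// exprMn exprS; nra.
have [K /(_ K (leqnn K)) hK] := tree_total_cvg t.+1 qlaw (divr_gt0 d0 (ltr0Sn R 1)).
pose good T := (generation_size t.+1 T)%:R * theta ^+ t.+1 <= delta.
exists t.+1, [seq T <- trees K t.+1 | good T]; split.
- by rewrite filter_uniq// trees_uniq.
- move=> T; rewrite mem_filter => /andP[gT TK]; split=> //.
  exact: trees_has_generations TK.
rewrite big_filter.
have bad : delta * \sum_(T <- trees K t.+1 | ~~ good T) branching_mass rho q t.+1 T <=
    delta * (delta / 2).
  apply: le_trans ht; rewrite mulr_sumr.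
  apply: (@le_trans _ _ (generation_total q K t.+1 * theta ^+ t.+1)); last first.
    by rewrite ler_wpM2r ?exprn_ge0// generation_total_le.
  rewrite /generation_total mulr_suml [leRHS](bigID good) ler_wpDl//.
    apply: sumr_ge0 => T _; rewrite mulr_ge0 ?exprn_ge0// mulr_ge0//.
    exact: branching_mass_ge0.
  apply: ler_sum => T; rewrite /good -ltNge => /ltW gT.
  by rewrite mulrC -mulrA; apply: ler_wpM2l gT; exact: branching_mass_ge0.
move: bad; rewrite ler_pM2l// => bad.
by move: hK; rewrite /tree_total (bigID good)/=; lra.
Qed.

End Mass.
End TreeEnumeration.

(** * Consequences of local convergence *)

Lemma rooted_iso_trans A B C : rooted_iso A B -> rooted_iso B C -> rooted_iso A C.
Proof.
move=> [f [fb fr fm]] [h [hb hr hm]]; exists (h \o f); split.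
- exact: set_bij_comp fb hb.
- by rewrite /= fr hr.
- have [fAB _ _] := fb.
  by move=> x y Ax Ay; rewrite /= hm ?fm//; exact: fAB.
Qed.

Lemma rooted_iso_sym A B : rg_verts A (rg_root A) -> rooted_iso A B -> rooted_iso B A.
Proof.
move=> rA [f [[fAB finj fsurj] fr fm]].
have /choice[h hP] : forall y, exists x, rg_verts B y -> rg_verts A x /\ f x = y.
  move=> y.
  have [/fsurj[x Ax fx]|nBy] := pselect (rg_verts B y); first by exists x.
  by exists (rg_root A).
have hf x : rg_verts A x -> h (f x) = x.
  move=> Ax; have [Ah fh] := hP _ (fAB _ Ax).
  by apply: finj => //; rewrite inE.
exists h; split.
- split=> [y /hP[]//|y z|x Ax].
    by rewrite !inE => /hP[_ fy] /hP[_ fz] hyz; rewrite -fy -fz hyz.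
  by exists (f x); [exact: fAB|exact: hf].
- by rewrite -fr hf.
- move=> y z /hP[Ay fy] /hP[Az fz].
  by rewrite -(fm _ _ Ay Az) fy fz.
Qed.

Lemma rooted_iso_refl A : rooted_iso A A.
Proof.
exists id; split=> //; split=> // x Ax; by exists x.
Qed.

Notation tree_iso T T' := (rooted_iso (tree_graph T) (tree_graph T')).

Lemma tree_iso_sym T T' : tree_iso T T' -> tree_iso T' T.
Proof. exact: rooted_iso_sym. Qed.

Section IsoRepresentatives.
Variable A : seq ptree.

(** Several trees of the list may be isomorphic, and then the same balls are
    counted by each of them; the first one stands for its class. *)
Definition iso_rep (T : ptree) : ptree :=
  nth T A (find (fun T' => `[< tree_iso T T' >]) A).

Lemma iso_repP T : T \in A -> iso_rep T \in A /\ tree_iso T (iso_rep T).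
Proof.
move=> TA; have h : has (fun T' => `[< tree_iso T T' >]) A.
  by apply/hasP; exists T => //; apply/asboolP; exact: rooted_iso_refl.
split; first by rewrite mem_nth// -has_find.
exact/asboolP/(nth_find T h).
Qed.

Lemma iso_rep_eq T T' : T \in A -> tree_iso T T' -> iso_rep T = iso_rep T'.
Proof.
move=> TA TT'; rewrite /iso_rep.
have -> : (fun T0 => `[< tree_iso T' T0 >]) = (fun T0 => `[< tree_iso T T0 >]).
  apply/funext => T0; apply/asbool_equiv_eq; split; apply: rooted_iso_trans => //.
  exact: tree_iso_sym.
apply: set_nth_default; rewrite -has_find; apply/hasP; exists T => //.
by apply/asboolP; exact: rooted_iso_refl.
Qed.

Lemma iso_rep_unique r r' : r \in map iso_rep A -> r' \in map iso_rep A ->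
  tree_iso r r' -> r = r'.
Proof.
move=> /mapP[T TA ->] /mapP[T' T'A ->] rr'; apply: iso_rep_eq => //.
have [_ Tr] := iso_repP TA; have [_ Tr'] := iso_repP T'A.
apply: rooted_iso_trans Tr _; apply: rooted_iso_trans rr' _.
exact: tree_iso_sym.
Qed.

End IsoRepresentatives.

Lemma near_all_seq (T : eqType) (U : Type) (F : set_system U) {FF : Filter F}
    (s : seq T) (Q : T -> U -> Prop) :
  (forall x, x \in s -> \forall y \near F, Q x y) ->
  \forall y \near F, forall x, x \in s -> Q x y.
Proof.
elim: s => [|x s IH] h; first by apply: nearW.
have h1 := h x (mem_head _ _).
have h2 : \forall y \near F, forall x, x \in s -> Q x y.
  by apply: IH => z zs; apply: h; rewrite inE zs orbT.
near=> y => z; rewrite inE => /orP[/eqP ->|]; first by near: y.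
by move: z; near: y.
Unshelve. all: by end_near. Qed.

Lemma count_le_has (T : eqType) (s : seq T) (Q : pred T) : uniq s ->
  (forall x y, x \in s -> y \in s -> Q x -> Q y -> x = y) ->
  (count Q s <= has Q s)%N.
Proof.
elim: s => //= x s IH /andP[xs us] h.
have [Qx|_] /= := boolP (Q x); last first.
  by apply: IH => // y z ys zs; apply: h; rewrite inE ?ys ?zs orbT.
have -> // : count Q s = 0%N.
apply/eqP; rewrite -leqn0 leqNgt -has_count; apply/hasPn => y ys; apply/negP => Qy.
by move: xs; rewrite (h x y) ?mem_head ?inE ?ys ?orbT.
Qed.

Section LocalLimit.
Variables (R : realType) (p : nat -> R) (g : forall N, multigraph N).
Hypothesis tree_like : locally_tree_like g p.

Lemma near_ball_frequency t T b : has_generations t T ->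
  (b%:E < branching_prob p t T)%E ->
  \forall N \near \oo, b < ball_frequency R g t T N.
Proof.
move=> /tree_like lim_freq bT.
have := lim_freq _ (open_ereal_gt' bT).
by rewrite /nbhs/=; apply: filterS => N; rewrite /= lte_fin.
Qed.

Lemma branching_prob_ge t T (A : seq ptree) : uniq A ->
  (forall T', T' \in A -> tree_iso T' T) ->
  ((\sum_(T' <- A) branching_mass (size_biased p) p t T')%:E <= branching_prob p t T)%E.
Proof.
move=> uA AT; apply: esum_ge; exists [set` A].
  by split; [exact: finite_seq|move=> T' /AT].
by rewrite -fsbig_seq//= sumEFin.
Qed.

Definition sees_tree_in N (h : multigraph N) t (A : seq ptree) (i : 'I_N) : bool :=
  has (fun T => `[< rooted_iso (ball_graph h i t) (tree_graph T) >]) A.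

(** The balls isomorphic to different representatives are disjoint events, so
    the proportion of good vertices is the sum of the frequencies of the
    representatives, whose limits add up to at least the mass of the list. *)
Lemma near_good_vertices t (A : seq ptree) (a eta : R) : uniq A ->
  (forall T, T \in A -> has_generations t T) ->
  a <= \sum_(T <- A) branching_mass (size_biased p) p t T -> 0 < eta ->
  \forall N \near \oo, (a - eta) * N%:R <=
    #|[set i : 'I_N | sees_tree_in (g N) t A i]%SET|%:R.
Proof.
move=> uA At ha eta0.
pose F := undup (map (iso_rep A) A).
have FA r : r \in F -> r \in A.
  by rewrite mem_undup => /mapP[T TA ->]; have [] := iso_repP TA.
pose b r := \sum_(T <- A | iso_rep A T == r) branching_mass (size_biased p) p t T.
have bF : \sum_(T <- A) branching_mass (size_biased p) p t T = \sum_(r <- F) b r.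
  rewrite /b; under [RHS]eq_bigr do rewrite big_mkcond.
  rewrite exchange_big/=; apply: eq_big_seq => T TA.
  rewrite (bigD1_seq (iso_rep A T)) ?undup_uniq ?mem_undup ?map_f//= eqxx.
  by rewrite big1 ?addr0// => r; rewrite eq_sym => /negPf ->.
(* an error c for each of the representatives, eta in total *)
pose c := eta / (size F).+1%:R.
have c0 : 0 < c by rewrite divr_gt0.
have freq : \forall N \near \oo, forall r, r \in F -> b r - c < ball_frequency R g t r N.
  apply: near_all_seq => r rF; apply: near_ball_frequency; first exact/At/FA.
  apply: (@lt_le_trans _ _ (b r)%:E); first by rewrite lte_fin gtrBl.
  rewrite /b -big_filter; apply: branching_prob_ge; first exact: filter_uniq.
  by move=> T; rewrite mem_filter => /andP[/eqP <- TA]; have [] := iso_repP TA.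
near=> N.
have N0 : 0 < N%:R :> R by rewrite ltr0n; near: N; exact: nbhs_infty_gt.
have freqN : forall r, r \in F -> b r - c < ball_frequency R g t r N by near: N.
pose ball_iso r (i : 'I_N) := `[< rooted_iso (ball_graph (g N) i t) (tree_graph r) >].
have step1 : a - eta <= \sum_(r <- F) ball_frequency R g t r N.
  apply: (@le_trans _ _ (\sum_(r <- F) (b r - c))); last first.
    by rewrite big_seq [leRHS]big_seq ler_sum// => r /freqN /ltW.
  rewrite big_split/= -bF lerD// sumrN lerN2 big_const_seq count_predT iter_addr_0.
  rewrite -mulr_natr /c mulrAC ler_pdivrMr// ler_pM2l// ler_nat//.
rewrite -ler_pdivlMr//; apply: le_trans step1 _.
rewrite /ball_frequency -mulr_suml ler_pM2r ?invr_gt0// -natr_sum ler_nat.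
have -> : (\sum_(r <- F) #|[set i | ball_iso r i]%SET|)%N =
    (\sum_(i < N) count (ball_iso ^~ i) F)%N.
  under eq_bigr do rewrite -sum1_card big_mkcond.
  rewrite exchange_big/=; apply: eq_bigr => i _.
  by rewrite -sum1_count [RHS]big_mkcond; apply: eq_bigr => r _; rewrite inE.
rewrite -sum1_card [leqRHS]big_mkcond/=; apply: leq_sum => i _; rewrite inE /sees_tree_in.
have ball_root : rg_verts (ball_graph (g N) i t) (rg_root (ball_graph (g N) i t)).
  by exists [::].
apply: (@leq_trans (has (ball_iso ^~ i) F)).
  apply: count_le_has; first exact: undup_uniq.
  move=> r r'; rewrite !mem_undup => rF rF' /asboolP ir /asboolP ir'.
  apply: iso_rep_unique rF rF' _.
  exact: rooted_iso_trans (rooted_iso_sym ball_root ir) ir'.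
case: hasP => [[r rF ir]|//]; case: hasP => // -[]; exists r => //; exact: FA.
Unshelve. all: by end_near. Qed.

(** A good vertex has a row sum of correlations of at most K + N delta, any
    other vertex one of at most N. *)
Lemma zero_field_variance_cvg (beta : R) : 0 <= beta ->
  (forall delta : R, 0 < delta -> exists t (A : seq ptree), [/\ uniq A,
    forall T, T \in A -> has_generations t T /\
      (generation_size t T)%:R * tanh_ratio beta ^+ t <= delta &
    1 - delta <= \sum_(T <- A) branching_mass (size_biased p) p t T]) ->
  spin_variance (g N) beta 0 / N%:R ^+ 2 @[N --> \oo] --> (0 : R).
Proof.
move=> beta0 typical; apply/cvgrPdist_le => e e0.
(* four errors of e / 4: outside of a good ball, inside of it, the mass missing
   in the list of trees, and the fluctuation of its frequency *)
have e4 : 0 < e / 4 by rewrite divr_gt0.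
have [t [A [uA At massA]]] := typical _ e4.
pose K := (\sum_(T <- A) size (node_list t T))%N.
have goodN := near_good_vertices uA (fun T TA => (At T TA).1) massA e4.
near=> N.
have N0 : 0 < N%:R :> R by rewrite ltr0n; near: N; exact: nbhs_infty_gt.
have KN : K%:R <= e / 4 * N%:R.
  rewrite mulrC -ler_pdivrMr ?divr_gt0//; near: N; exact: nbhs_infty_ger.
have cardN : (1 - e / 4 - e / 4) * N%:R <=
    #|[set i : 'I_N | sees_tree_in (g N) t A i]%SET|%:R.
  by near: N; exact: goodN.
pose good := sees_tree_in (g N) t A.
have corr_ge0 i j := correlation_ge0 beta0 (g N) i j.
rewrite sub0r normrN spin_variance0 ger0_norm; last first.
  by rewrite divr_ge0 ?exprn_ge0// sumr_ge0// => i _; rewrite sumr_ge0.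
rewrite ler_pdivrMr ?exprn_gt0//.
pose row i := \sum_j correlation beta (g N) i j.
have row_good i : good i -> row i <= e / 2 * N%:R.
  move=> /hasP[T TA /asboolP[f [fb fr fm]]].
  have [Tt Td] := At T TA.
  apply: le_trans (ball_row_sum_le beta0 fb fr fm Tt Td) _.
  have : (size (node_list t T))%:R <= K%:R :> R.
    by rewrite ler_nat /K (big_rem T)//= leq_addr.
  lra.
have row_all i : row i <= N%:R.
  rewrite -[leRHS]mulr1 -[N in leRHS]card_ord -sumr_const mulr_suml ler_sum// => j _.
  by rewrite mul1r correlation_le1.
apply: (@le_trans _ _ (\sum_(i < N) (e / 2 * N%:R + (~~ good i)%:R * N%:R))).
  apply: ler_sum => i _; have [/row_good rg|_] := boolP (good i).
    by rewrite mul0r addr0.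
  by rewrite mul1r (le_trans (row_all i))// lerDr mulr_ge0// divr_ge0// ltW.
rewrite big_split/= sumr_const card_ord -mulr_suml -(mulr_natl (e / 2 * _)).
have -> : \sum_(i < N) (~~ good i)%:R = N%:R - #|[set i | good i]%SET|%:R :> R.
  have -> : N%:R = \sum_(i < N) (1 : R) by rewrite sumr_const card_ord.
  rewrite -sum1_card natr_sum [X in _ - X]big_mkcond -sumrB.
  by apply: eq_bigr => i _; rewrite inE; case: (good i); rewrite ?subrr ?subr0.
have : (N%:R - #|[set i | good i]%SET|%:R) * N%:R <= e / 2 * N%:R * N%:R.
  rewrite ler_pM2r//; lra.
rewrite expr2; lra.
Unshelve. all: by end_near. Qed.
End LocalLimit.

(** * The degree law in the subcritical regime *)

Section DegreeLaws.
Variables (R : realType).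

Lemma nneseries_partial_sums (f : nat -> R) (l : R) :
  (forall n, 0 <= f n) -> (\sum_(0 <= n <oo) (f n)%:E = l%:E)%E ->
  (forall K, \sum_(0 <= n < K) f n <= l) /\
  (forall d, 0 < d -> exists K, l - d <= \sum_(0 <= n < K) f n).
Proof.
move=> f0 fl; split=> [K|d d0].
  by rewrite -lee_fin -sumEFin -fl; apply: nneseries_lim_ge => n _ _; rewrite lee_fin.
have cv := @is_cvg_nneseries R (fun n => (f n)%:E) predT 0 (fun n _ _ => f0 n).
have /cvgP := cv; have : ((l - d)%:E < limn (fun n => (\sum_(0 <= i < n) (f i)%:E)%R))%E.
  by rewrite fl lte_fin; lra.
move=> lt _; have := cv _ (open_ereal_gt' lt).
rewrite /nbhs/= => -[K _ /(_ K (leqnn K))]/=.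
by rewrite sumEFin lte_fin => /ltW ?; exists K.
Qed.

Variable p : nat -> R.
Hypothesis p_law : is_degree_law p.
Hypothesis mean_fin : (mean_degree p < +oo)%E.

Let m := fine (mean_degree p).

Lemma degree_probability_law : probability_law p.
Proof.
case: p_law => p0 _ /(nneseries_partial_sums p0)[h1 h2].
by split.
Qed.

Lemma mean_terms_ge0 n : 0 <= n%:R * p n.
Proof. by case: p_law => p0 _ _; rewrite mulr_ge0. Qed.

Lemma mean_degreeE : mean_degree p = m%:E.
Proof.
rewrite fineK// ge0_fin_numE//.
by apply: nneseries_ge0 => n _ _; rewrite lee_fin mean_terms_ge0.
Qed.

(** Degrees are at least 1. *)
Lemma mean_degree_ge1 : 1 <= m.
Proof.
have [p0 pz /(nneseries_partial_sums p0)[_ near1]] := p_law.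
have [hm _] := nneseries_partial_sums mean_terms_ge0 mean_degreeE.
apply/ler_addgt0Pr => e e0; have [K hK] := near1 e e0.
rewrite -lerBlDr; apply: le_trans hK (le_trans _ (hm K)).
apply: ler_sum => n _; case: n => [|n]; first by rewrite pz mulr0.
by rewrite ler_peMl// ler1n.
Qed.

Lemma size_biased_ge0 n : 0 <= size_biased p n.
Proof.
by case: p_law => p0 _ _; rewrite divr_ge0 ?mulr_ge0// (le_trans _ mean_degree_ge1).
Qed.

Lemma size_biased_sum K :
  \sum_(0 <= n < K) size_biased p n = (\sum_(0 <= n < K.+1) n%:R * p n) / m.
Proof.
by rewrite big_nat_recl//= mul0r add0r mulr_suml.
Qed.

Lemma size_biased_law : probability_law (size_biased p).
Proof.
have m0 : 0 < m by apply: lt_le_trans mean_degree_ge1.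
have [hm hm2] := nneseries_partial_sums mean_terms_ge0 mean_degreeE.
split=> [|K|d d0]; first exact: size_biased_ge0.
  by rewrite size_biased_sum ler_pdivrMr// mul1r.
have [K hK] := hm2 (d * m) (mulr_gt0 d0 m0); exists K.
rewrite size_biased_sum ler_pdivlMr// mulrBl mul1r (le_trans hK)//.
by rewrite big_nat_recr//= lerDl mean_terms_ge0.
Qed.

Lemma tanh_ratio_lt1 (beta : R) : tanh_ratio beta < 1.
Proof.
have := expR_gt0 beta; have := expR_gt0 (- beta); rewrite /tanh_ratio => h1 h2.
by rewrite ltr_pdivrMr ?addr_gt0//; lra.
Qed.

(** In terms of exp (2 beta) both sides say that it is less than
    (1 + x) / (1 - x). *)
Lemma tanh_ratio_lt (beta x : R) : 0 < x -> x < 1 ->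
  beta < atanh x -> tanh_ratio beta < x.
Proof.
move=> x0 x1; rewrite /atanh ltr_pdivlMr// => h.
have q0 : 0 < (1 + x) / (1 - x) by rewrite divr_gt0; lra.
have : expR (beta * 2) < (1 + x) / (1 - x) by rewrite -[ltRHS]lnK ?posrE// ltr_expR.
have x1' : 0 < 1 - x by lra.
rewrite ltr_pdivlMr// mulr_natr mulr2n expRD.
have := expR_gt0 beta; have := expR_gt0 (- beta); have := expRxMexpNx_1 beta.
rewrite /tanh_ratio; set a := expR beta; set b := expR (- beta) => ab b0 a0 hx.
rewrite ltr_pdivrMr ?addr_gt0//.
have : 0 < b * ((1 + x) - a * a * (1 - x)) by rewrite mulr_gt0// subr_gt0.
have -> : b * (1 + x - a * a * (1 - x)) = b * (1 + x) - (a * b) * a * (1 - x) by ring.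
rewrite ab; lra.
Qed.

(** The three cases in the definition of the critical value: for nu <= 1 the
    claim follows from tanh beta < 1, and nu is finite otherwise because beta
    is positive and below the critical value. *)
Lemma subcritical (beta : R) : 0 < beta -> (beta%:E < beta_c p)%E ->
  exists v : R, [/\ 0 <= v, nu p = v%:E & v * tanh_ratio beta < 1].
Proof.
move=> b0 bc.
have nu0 : (0 <= nu p)%E.
  by apply: nneseries_ge0 => n _ _; rewrite lee_fin mulr_ge0// size_biased_ge0.
move: bc; rewrite /beta_c; case: ifPn => [nu1 _|].
  have nuf : nu p \is a fin_num by rewrite ge0_fin_numE// (le_lt_trans nu1) ?ltry.
  exists (fine (nu p)); rewrite fineK// fine_ge0//; split=> //.
  have : fine (nu p) <= 1 by rewrite -lee_fin fineK.
  have := tanh_ratio_lt1 beta; have := tanh_ratio_ge0 (ltW b0).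
  have : 0 <= fine (nu p) by rewrite fine_ge0.
  nra.
rewrite -ltNge => nu1; case: eqP => [_|/eqP nuy].
  by rewrite lte_fin => /(lt_trans b0); rewrite ltxx.
have nuf : nu p \is a fin_num by rewrite ge0_fin_numE// lt_neqAle nuy leey.
rewrite lte_fin => /tanh_ratio_lt.
have v1 : 1 < fine (nu p) by rewrite -lte_fin fineK.
have v0 : 0 < fine (nu p) by apply: lt_trans v1.
rewrite invr_gt0 invf_lt1// => /(_ v0 v1) h.
exists (fine (nu p)); rewrite fineK// (ltW v0); split=> //.
by rewrite mulrC -ltr_pdivlMr// div1r.
Qed.

Lemma subcritical_typical_trees (beta : R) : 0 < beta -> (beta%:E < beta_c p)%E ->
  forall delta : R, 0 < delta -> exists t (A : seq ptree), [/\ uniq A,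
    forall T, T \in A -> has_generations t T /\
      (generation_size t T)%:R * tanh_ratio beta ^+ t <= delta &
    1 - delta <= \sum_(T <- A) branching_mass (size_biased p) p t T].
Proof.
move=> b0 /(subcritical b0)[v [v0 nuv vth]] delta d0.
have [hm _] := nneseries_partial_sums mean_terms_ge0 mean_degreeE.
have nu_terms n : 0 <= n%:R * size_biased p n by rewrite mulr_ge0// size_biased_ge0.
have [hv _] := nneseries_partial_sums nu_terms nuv.
exact: (typical_trees size_biased_law degree_probability_law v0
  (tanh_ratio_ge0 (ltW b0)) vth d0 hm hv).
Qed.

End DegreeLaws.

(** * From the variance to the averaged measure *)

Section Concentration.
Variables (R : realType).

Lemma chebyshev_magnetization N (g : multigraph N) (beta B a eps : R) :
  (0 < N)%N -> 0 < eps ->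
  \sum_(s : config N | eps < `|total_spin R s / N%:R - a|) quenched g beta B s <=
  (spin_variance g beta B / N%:R ^+ 2 + (finite_magnetization g beta B - a) ^+ 2)
    / eps ^+ 2.
Proof.
move=> N0 e0.
have N0' : N%:R != 0 :> R by rewrite pnatr_eq0 -lt0n.
have m0 : spin_moment g beta B 0 != 0 by rewrite gt_eqF ?spin_moment0_gt0.
have q0 s : 0 <= quenched g beta B s.
  by rewrite divr_ge0 ?expR_ge0// ltW// partition_function_gt0.
have -> : spin_variance g beta B / N%:R ^+ 2 + (finite_magnetization g beta B - a) ^+ 2 =
    \sum_(s : config N) quenched g beta B s * (total_spin R s / N%:R - a) ^+ 2.
  have -> : finite_magnetization g beta B =
      spin_moment g beta B 1 / spin_moment g beta B 0 / N%:R.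
    rewrite /finite_magnetization /quenched partition_functionE /spin_moment !mulr_suml.
    by apply: eq_bigr => s _; rewrite expr1; ring.
  transitivity ((a ^+ 2 * spin_moment g beta B 0 +
      (- 2 * a / N%:R) * spin_moment g beta B 1 +
      N%:R ^- 2 * spin_moment g beta B 2 + 0 * spin_moment g beta B 3) /
      spin_moment g beta B 0).
    by rewrite /spin_variance /mean_spin; field; rewrite N0' m0.
  rewrite -(@sum_cubic _ _ _ _ _
    (fun s => ising_weight g beta B s * (total_spin R s / N%:R - a) ^+ 2)).
    rewrite mulr_suml; apply: eq_bigr => s _.
    by rewrite /quenched partition_functionE; ring.
  by move=> s; field.
rewrite ler_pdivlMr ?exprn_gt0// mulr_suml.
rewrite [leRHS](bigID (fun s : config N => eps < `|total_spin R s / N%:R - a|))/=.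
rewrite ler_wpDr//.
  by apply: sumr_ge0 => s _; rewrite mulr_ge0// sqr_ge0.
apply: ler_sum => s /ltW es; rewrite ler_wpM2l//.
by rewrite -[leRHS]real_normK ?num_real// lerXn2r ?nnegrE// ltW.
Qed.

Lemma quenched_concentration (g : forall N, multigraph N) (beta B a eps : R) :
  0 < eps ->
  (exists2 v : nat -> R, v N @[N --> \oo] --> 0 & forall N : nat, (0 < N)%N ->
     spin_variance (g N) beta B / N%:R ^+ 2 <= v N) ->
  finite_magnetization (g N) beta B @[N --> \oo] --> a ->
  (\sum_(s : config N | eps < `|total_spin R s / N%:R - a|) quenched (g N) beta B s)
    @[N --> \oo] --> 0.
Proof.
move=> e0 [v v0 hv] mag.
apply: (@squeeze_cvgr _ _ _ _ (fun=> 0)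
  (fun N => (v N + (finite_magnetization (g N) beta B - a) ^+ 2) / eps ^+ 2)).
- near=> N; rewrite sumr_ge0/=; last first.
    by move=> s _; rewrite divr_ge0 ?expR_ge0// ltW// partition_function_gt0.
  have N0 : (0 < N)%N by near: N; exact: nbhs_infty_gt.
  apply: le_trans (chebyshev_magnetization _ _ _ _ N0 e0) _.
  by rewrite ler_pM2r ?invr_gt0 ?exprn_gt0// lerD2r hv.
- exact: cvg_cst.
- have -> : 0 = (0 + (a - a) ^+ 2) / eps ^+ 2 :> R by rewrite subrr expr0n addr0 mul0r.
  apply: cvgMr_tmp; apply: cvgD => //.
  rewrite expr2; under eq_fun do rewrite expr2.
  by apply: cvgM; apply: cvgB => //; exact: cvg_cst.
Unshelve. all: by end_near. Qed.

Section Averaging.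
Variables (d : measure_display) (Omega : measurableType d) (P : probability Omega R).
Variable G : forall N : nat, Omega -> multigraph N.
Hypothesis G_random : random_multigraphs G.

(** There are countably many multigraphs on N vertices. *)
Lemma measurable_graph_function N (f : multigraph N -> R) :
  measurable_fun setT (fun w => f (G N w)).
Proof.
move=> _ Y _; rewrite setTI.
have -> : (fun w => f (G N w)) @^-1` Y =
    \bigcup_(h : multigraph N) (if f h \in Y then G N @^-1` [set h] else set0).
  apply/seteqP; split=> [w Yw|w [h _]].
    by exists (G N w) => //; rewrite mem_set.
  by case: ifPn => // /set_mem Yf /= ->.
apply: countable_bigcupT_measurable; first exact: countableP.
by move=> h; case: ifP => _; [exact: G_random|exact: measurable0].
Qed.

Lemma averaged_quenched_cvg0 (beta B : R) (A : forall N, pred (config N)) :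
  {ae P, forall w,
    (\sum_(s | A N s) quenched (G N w) beta B s) @[N --> \oo] --> (0 : R)} ->
  averaged_quenched_prob P G beta B (A N) @[N --> \oo] --> 0%:E.
Proof.
move=> cv.
pose f N w := \sum_(s | A N s) quenched (G N w) beta B s.
have q0 N w s : 0 <= quenched (G N w) beta B s.
  by rewrite divr_ge0 ?expR_ge0// ltW// partition_function_gt0.
have fE N : averaged_quenched_prob P G beta B (A N) = (\int[P]_w (f N w)%:E)%E.
  rewrite /averaged_quenched_prob /averaged_quenched expectation.unlock.
  rewrite -big_filter -ge0_integral_sum//; last 2 first.
  - move=> s; apply/measurable_EFinP.
    exact: (@measurable_graph_function N (fun h => quenched h beta B s)).
  - by move=> s w _; rewrite lee_fin.
  by apply: eq_integral => w _; rewrite /f sumEFin big_filter.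
under eq_cvg do rewrite fE.
have mf N : measurable_fun setT (fun w => (f N w)%:E).
  by apply/measurable_EFinP; exact: (@measurable_graph_function N
    (fun h => \sum_(s | A N s) quenched h beta B s)).
have [|||_ _] := @dominated_convergence _ _ _ P setT measurableT
  (fun N w => (f N w)%:E) (cst 0%E) (cst 1%E) mf (measurable_cst _).
- apply: filterS cv => w fw _.
  by apply: cvg_EFin; [exact: nearW|exact: fw].
- exact: finite_measure_integrable_cst.
- apply: nearW => w N _; rewrite abse_EFin lee_fin ger0_norm ?sumr_ge0//.
  rewrite /f (@le_trans _ _ (\sum_s quenched (G N w) beta B s))//.
    by rewrite [leRHS](bigID (A N))/= lerDl sumr_ge0.
  by rewrite -mulr_suml divff// gt_eqF// partition_function_gt0.
- by rewrite integral0.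
Qed.

End Averaging.
End Concentration.

Theorem theorem1p4 (R : realType) (d : measure_display)
    (Omega : measurableType d) (P : probability Omega R)
    (G : forall N : nat, Omega -> multigraph N)
    (p : nat -> R) (M : R -> R -> R) :
  random_multigraphs G ->
  is_degree_law p ->
  (mean_degree p < +oo)%E ->
  {ae P, forall w, locally_tree_like (fun N => G N w) p} ->
  {ae P, forall w, uniformly_sparse R (fun N => G N w)} ->
  strongly_finite_mean p ->
  is_magnetization P G p M ->
  forall beta B : R, Uqu p beta B ->
  forall eps : R, 0 < eps ->
    averaged_quenched_prob P G beta B
      (fun s : config N => eps < `|total_spin R s / N%:R - M beta B|)
    @[N --> \oo] --> 0%:E.
Proof.
move=> Grand plaw mfin tree_like _ _ magn beta B BU eps eps0.
apply: (@averaged_quenched_cvg0 _ _ _ P G Grand beta B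
  (fun N (s : config N) => eps < `|total_spin R s / N%:R - M beta B|)).
have magnB := magn beta B BU.
apply: filterS2 tree_like magnB => w tree_w magn_w.
apply: quenched_concentration magn_w => //.
case: BU => [[b0 /eqP B0]|[b0 bc ->]].
(* 1 / (|B| N) <= (2 / |B|) / (N + 1) *)
- exists (fun N => 2 / `|B| * harmonic N).
    rewrite -(mulr0 (2 / `|B|)); apply: cvgMl_tmp; exact: cvg_harmonic.
  move=> N N0; apply: (@le_trans _ _ (N%:R / `|B| / N%:R ^+ 2)).
    by rewrite ler_wpM2r ?invr_ge0 ?exprn_ge0// spin_variance_le.
  have N0' : 0 < N%:R :> R by rewrite ltr0n.
  have B0' : 0 < `|B| by rewrite normr_gt0.
  have -> : N%:R / `|B| / N%:R ^+ 2 = `|B|^-1 / N%:R by field; rewrite !gt_eqF.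
  rewrite [2 / _]mulrC /harmonic -mulrA ler_pM2l ?invr_gt0//.
  rewrite -(@ler_pM2r _ N%:R)// mulVf ?gt_eqF//.
  rewrite mulrAC ler_pdivlMr// mul1r -natrM ler_nat; lia.
- exists (fun N => spin_variance (G N w) beta 0 / N%:R ^+ 2) => //.
  apply: (zero_field_variance_cvg tree_w (ltW b0)).
  exact: subcritical_typical_trees.
Qed.
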